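(* $\mathsf{WOAM}$ implies Kurepa's theorem $\mathsf{CAC}^{\aleph_{0}}_{1}$ in $\mathsf{ZF}$.
   Context: $\mathsf{ZF}$ is Zermelo–Fraenkel set theory without the Axiom of Choice. An infinite set is amorphous if it is not a disjoint union of two infinite subsets. $\mathsf{WOAM}$: every set is either well-orderable or has an amorphous subset. $\mathsf{CAC}^{\aleph_{0}}_{1}$: every partially ordered set such that all of its antichains are finite and all of its chains are countable is countable. Here a chain is a linearly ordered subset, an antichain is a set of pairwise incomparable elements, and $X$ is countable if $|X|\leq\aleph_{0}$. *)

(* Defs.v *)
(** Models of first-order ZF, and set-theoretic notions relativized to a model.

    All the notions below quantify over the elements of a model only, so each
    is (the Tarskian interpretation of) a first-order formula in the language
    {∈}.  In particular finiteness, countability and well-orderability are the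
    internal ones, witnessed by sets of the model. *)

Set Implicit Arguments.
Unset Strict Implicit.
Unset Printing Implicit Defensive.

Record structure : Type := Structure {
  carrier :> Type;
  mem : carrier -> carrier -> Prop
}.

Declare Scope set_scope.
Notation "x ∈ y" := (mem x y) (at level 70, no associativity) : set_scope.
Open Scope set_scope.

(** ** First-order formulas *)

(** Variables are de Bruijn indices; [fAll] and [fEx] bind index 0. *)
Inductive formula : Type :=
| fMem : nat -> nat -> formula
| fEq  : nat -> nat -> formula
| fBot : formula
| fAnd : formula -> formula -> formula
| fOr  : formula -> formula -> formula
| fImp : formula -> formula -> formula
| fAll : formula -> formula
| fEx  : formula -> formula.

Definition scons (T : Type) (a : T) (rho : nat -> T) : nat -> T :=
  fun n => match n with O => a | S k => rho k end.

Fixpoint sat (M : structure) (rho : nat -> M) (phi : formula) : Prop :=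
  match phi with
  | fMem i j => rho i ∈ rho j
  | fEq i j  => rho i = rho j
  | fBot     => False
  | fAnd p q => sat rho p /\ sat rho q
  | fOr p q  => sat rho p \/ sat rho q
  | fImp p q => sat rho p -> sat rho q
  | fAll p   => forall a : M, sat (scons a rho) p
  | fEx p    => exists a : M, sat (scons a rho) p
  end.

(** ** Basic notions *)

Definition subset (M : structure) (x y : M) : Prop :=
  forall z : M, z ∈ x -> z ∈ y.

Definition empty (M : structure) (x : M) : Prop :=
  forall z : M, ~ z ∈ x.

(** [p = {x, y}] *)
Definition is_upair (M : structure) (x y p : M) : Prop :=
  forall z : M, z ∈ p <-> z = x \/ z = y.

(** [p = (x, y) = {{x}, {x, y}}] *)
Definition is_opair (M : structure) (x y p : M) : Prop :=
  forall z : M, z ∈ p <-> is_upair x x z \/ is_upair x y z.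

(** [s = x ∪ {x}] *)
Definition is_succ (M : structure) (x s : M) : Prop :=
  forall z : M, z ∈ s <-> z ∈ x \/ z = x.

Definition inductive_set (M : structure) (w : M) : Prop :=
  (exists e : M, empty e /\ e ∈ w) /\
  (forall x : M, x ∈ w -> exists s : M, is_succ x s /\ s ∈ w).

(** ** The axioms of ZF *)

Record ZF (M : structure) : Prop := {
  ZF_extensionality :
    forall x y : M, (forall z : M, z ∈ x <-> z ∈ y) -> x = y;
  ZF_foundation :
    forall x : M, ~ empty x ->
      exists y : M, y ∈ x /\ forall z : M, z ∈ y -> ~ z ∈ x;
  ZF_pairing :
    forall x y : M, exists p : M, is_upair x y p;
  ZF_union :
    forall x : M, exists u : M,
      forall z : M, z ∈ u <-> exists y : M, y ∈ x /\ z ∈ y;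
  ZF_power_set :
    forall x : M, exists p : M, forall z : M, z ∈ p <-> subset z x;
  ZF_infinity :
    exists w : M, inductive_set w;
  (* [rho] assigns the parameters; index 0 of [phi] is the element tested *)
  ZF_separation :
    forall (phi : formula) (rho : nat -> M) (a : M),
      exists b : M, forall x : M,
        x ∈ b <-> x ∈ a /\ sat (scons x rho) phi;
  (* index 0 of [phi] is the argument and index 1 the value *)
  ZF_replacement :
    forall (phi : formula) (rho : nat -> M) (a : M),
      (forall x y y' : M, x ∈ a ->
         sat (scons x (scons y rho)) phi ->
         sat (scons x (scons y' rho)) phi -> y = y') ->
      exists b : M, forall y : M,
        y ∈ b <-> exists x : M, x ∈ a /\ sat (scons x (scons y rho)) phi
}.

(** ** Relations and functions *)

(** [(x, y) ∈ r] *)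
Definition related (M : structure) (r x y : M) : Prop :=
  exists p : M, is_opair x y p /\ p ∈ r.

(** [r ⊆ a × b] *)
Definition relation_between (M : structure) (r a b : M) : Prop :=
  forall p : M, p ∈ r ->
    exists x y : M, x ∈ a /\ y ∈ b /\ is_opair x y p.

Definition is_function (M : structure) (f a b : M) : Prop :=
  relation_between f a b /\
  forall x : M, x ∈ a -> exists! y : M, related f x y.

Definition is_injection (M : structure) (f a b : M) : Prop :=
  is_function f a b /\
  forall x x' y : M, related f x y -> related f x' y -> x = x'.

Definition is_bijection (M : structure) (f a b : M) : Prop :=
  is_injection f a b /\
  forall y : M, y ∈ b -> exists x : M, related f x y.

(** ** Finite and countable sets *)

(** ω is the least inductive set. *)
Definition is_omega (M : structure) (w : M) : Prop :=
  inductive_set w /\ forall v : M, inductive_set v -> subset w v.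

Definition finite (M : structure) (x : M) : Prop :=
  exists w n f : M, is_omega w /\ n ∈ w /\ is_bijection f x n.

Definition infinite (M : structure) (x : M) : Prop := ~ finite x.

(** [|x| ≤ ℵ₀]; finite sets are countable. *)
Definition countable (M : structure) (x : M) : Prop :=
  exists w f : M, is_omega w /\ is_injection f x w.

(** ** Orders *)

(** [r] is a reflexive partial order on [a]. *)
Definition partial_order (M : structure) (a r : M) : Prop :=
  relation_between r a a /\
  (forall x : M, x ∈ a -> related r x x) /\
  (forall x y : M, related r x y -> related r y x -> x = y) /\
  (forall x y z : M, related r x y -> related r y z -> related r x z).

Definition comparable (M : structure) (r x y : M) : Prop :=
  related r x y \/ related r y x.

Definition chain (M : structure) (a r c : M) : Prop :=
  subset c a /\ forall x y : M, x ∈ c -> y ∈ c -> comparable r x y.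

Definition antichain (M : structure) (a r c : M) : Prop :=
  subset c a /\
  forall x y : M, x ∈ c -> y ∈ c -> x <> y -> ~ comparable r x y.

Definition well_order (M : structure) (a r : M) : Prop :=
  partial_order a r /\
  (forall x y : M, x ∈ a -> y ∈ a -> comparable r x y) /\
  (forall b : M, subset b a -> ~ empty b ->
     exists m : M, m ∈ b /\ forall x : M, x ∈ b -> related r m x).

Definition well_orderable (M : structure) (a : M) : Prop :=
  exists r : M, well_order a r.

(** ** WOAM and Kurepa's theorem *)

Definition disjoint_union (M : structure) (a b c : M) : Prop :=
  (forall z : M, z ∈ a <-> z ∈ b \/ z ∈ c) /\
  (forall z : M, ~ (z ∈ b /\ z ∈ c)).

Definition amorphous (M : structure) (a : M) : Prop :=
  infinite a /\
  ~ exists b c : M, disjoint_union a b c /\ infinite b /\ infinite c.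

Definition WOAM (M : structure) : Prop :=
  forall x : M,
    well_orderable x \/ exists a : M, subset a x /\ amorphous a.

Definition CAC_aleph0_1 (M : structure) : Prop :=
  forall p r : M, partial_order p r ->
    (forall c : M, antichain p r c -> finite c) ->
    (forall c : M, chain p r c -> countable c) ->
    countable p.

(* Main.v *)
Require Import Defs.
From Stdlib Require Import ssreflect Classical PeanoNat.

(** Let P be a poset with finite antichains and countable chains.

    An amorphous set A carries no partial order with all antichains finite.
    Every x in A has finitely many predecessors or finitely many successors;
    passing to the converse order, infinitely many x have finitely many
    predecessors.  The number of predecessors is then a map to ω whose fibers
    are antichains, hence finite, and taking every other fiber cuts A into two
    infinite pieces.  In particular an amorphous set is not linearly orderable.
    So by WOAM our P is well-orderable, and so is the set of functions P -> ω,
    which is linearly ordered lexicographically; this makes countable unions of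
    countable subsets of P countable (ω₁ is regular).

    Suppose P is uncountable.  A greedy antichain Z among those for which the
    set X of elements incomparable to all of Z stays uncountable is finite and
    maximal, so each x in X is incomparable to only countably many elements of
    X.  A greedy maximal chain C of X is countable, and X is the union of C and
    of the sets of elements of X incomparable to some x in C: a contradiction. *)

Set Implicit Arguments.
Unset Strict Implicit.
Unset Printing Implicit Defensive.

(** * Definability with parameters *)

Fixpoint rename (xi : nat -> nat) (phi : formula) : formula :=
  let up n := match n with O => O | S k => S (xi k) end in
  match phi with
  | fMem i j => fMem (xi i) (xi j)
  | fEq i j => fEq (xi i) (xi j)
  | fBot => fBot
  | fAnd p q => fAnd (rename xi p) (rename xi q)
  | fOr p q => fOr (rename xi p) (rename xi q)
  | fImp p q => fImp (rename xi p) (rename xi q)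
  | fAll p => fAll (rename up p)
  | fEx p => fEx (rename up p)
  end.

Lemma sat_rename (M : structure) (phi : formula) :
  forall (xi : nat -> nat) (rho sigma : nat -> M),
  (forall n, sigma n = rho (xi n)) -> sat rho (rename xi phi) <-> sat sigma phi.
Proof.
  induction phi as [i j|i j| |p IHp q IHq|p IHp q IHq|p IHp q IHq|p IHp|p IHp];
    intros xi rho sigma E; simpl.
  - by rewrite !E.
  - by rewrite !E.
  - done.
  - by rewrite (IHp _ _ _ E) (IHq _ _ _ E).
  - by rewrite (IHp _ _ _ E) (IHq _ _ _ E).
  - by rewrite (IHp _ _ _ E) (IHq _ _ _ E).
  - split=> H a; [rewrite <- IHp|rewrite -> IHp]; try exact: (H a);
      by case=> //= n; rewrite E.
  - split=> -[a H]; exists a; [rewrite <- IHp|rewrite -> IHp]; try exact: H;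
      by case=> //= n; rewrite E.
Qed.

Lemma sat_ext (M : structure) (phi : formula) (rho sigma : nat -> M) :
  (forall n, rho n = sigma n) -> sat rho phi <-> sat sigma phi.
Proof.
  move=> E; transitivity (sat rho (rename (fun n => n) phi)).
    by symmetry; apply: sat_rename.
  by apply: sat_rename => n; rewrite E.
Qed.

(** A variable of a formula stands for either an entry of the environment or a
    parameter; [ev s e] is the resulting assignment. *)
Definition ev (M : structure) (t : nat + M) (e : nat -> M) : M :=
  match t with inl i => e i | inr c => c end.

(** A predicate on whole environments rather than a formula, so that definability is proved one
    connective at a time and a variable bound by a Rocq quantifier becomes an entry of [e]. *)
Definition dfn (M : structure) (P : (nat -> M) -> Prop) : Prop :=
  exists (phi : formula) (s : nat -> nat + M),
    forall e, P e <-> sat (fun n => ev (s n) e) phi.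

Definition term (M : structure) (t : (nat -> M) -> M) : Prop :=
  exists s : nat + M, forall e, t e = ev s e.

Notation dfn1 P := (dfn (fun e => P (e 0))).
Notation dfn2 R := (dfn (fun e => R (e 0) (e 1))).
Notation dfn3 R := (dfn (fun e => R (e 0) (e 1) (e 2))).

Section Definability.
Context (M : structure).
Implicit Types (P Q : (nat -> M) -> Prop) (t u v : (nat -> M) -> M).

Lemma term_var i : term (fun e : nat -> M => e i).
Proof. by exists (inl i). Qed.

Lemma term_cst (c : M) : term (fun _ => c).
Proof. by exists (inr c). Qed.

Lemma term_rename t (xi : nat -> nat) : term t -> term (fun e => t (fun n => e (xi n))).
Proof.
  move=> [[i|c] H]; [exists (inl (xi i))|exists (inr c)] => e; by rewrite H.
Qed.

Lemma dfn_iff_of P Q : (forall e, P e <-> Q e) -> dfn P -> dfn Q.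
Proof. move=> H [phi [s Hs]]; exists phi, s => e; by rewrite -H Hs. Qed.

Lemma dfn_mem t u : term t -> term u -> dfn (fun e => t e ∈ u e).
Proof.
  move=> [s Hs] [s' Hs'].
  exists (fMem 0 1), (fun n => match n with 0 => s | _ => s' end) => e /=.
  by rewrite Hs Hs'.
Qed.

Lemma dfn_eq t u : term t -> term u -> dfn (fun e => t e = u e).
Proof.
  move=> [s Hs] [s' Hs'].
  exists (fEq 0 1), (fun n => match n with 0 => s | _ => s' end) => e /=.
  by rewrite Hs Hs'.
Qed.

Lemma dfn_false : dfn (fun _ : nat -> M => False).
Proof. by exists fBot, (fun n => inl n). Qed.

(* The parameters of two formulas are merged on the even and the odd variables. *)
Lemma dfn_binary P Q :
  dfn P -> dfn Q ->
  exists (phi psi : formula) (s : nat -> nat + M), forall e,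
    (P e <-> sat (fun n => ev (s n) e) phi) /\
    (Q e <-> sat (fun n => ev (s n) e) psi).
Proof.
  move=> [phi [s Hs]] [psi [s' Hs']].
  exists (rename (fun n => 2 * n) phi), (rename (fun n => S (2 * n)) psi),
    (fun n => if Nat.even n then s (Nat.div2 n) else s' (Nat.div2 n)) => e.
  rewrite Hs Hs'; split; symmetry; apply: sat_rename => n.
  - by rewrite Nat.even_mul Nat.div2_double.
  - by rewrite Nat.even_succ Nat.odd_mul Nat.div2_succ_double.
Qed.

Lemma dfn_and P Q : dfn P -> dfn Q -> dfn (fun e => P e /\ Q e).
Proof.
  move=> dP dQ; have [phi [psi [s H]]] := dfn_binary dP dQ.
  exists (fAnd phi psi), s => e; have [-> ->] := H e; done.
Qed.

Lemma dfn_or P Q : dfn P -> dfn Q -> dfn (fun e => P e \/ Q e).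
Proof.
  move=> dP dQ; have [phi [psi [s H]]] := dfn_binary dP dQ.
  exists (fOr phi psi), s => e; have [-> ->] := H e; done.
Qed.

Lemma dfn_imp P Q : dfn P -> dfn Q -> dfn (fun e => P e -> Q e).
Proof.
  move=> dP dQ; have [phi [psi [s H]]] := dfn_binary dP dQ.
  exists (fImp phi psi), s => e; have [-> ->] := H e; done.
Qed.

Lemma dfn_not P : dfn P -> dfn (fun e => ~ P e).
Proof. move=> dP; exact: dfn_imp dP dfn_false. Qed.

Lemma dfn_iff P Q : dfn P -> dfn Q -> dfn (fun e => P e <-> Q e).
Proof. by move=> dP dQ; apply: dfn_and; apply: dfn_imp. Qed.

Lemma dfn_quantifier (Q : M -> (nat -> M) -> Prop) :
  dfn (fun e => Q (e 0) (fun n => e (S n))) ->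
  exists (phi : formula) (s : nat -> nat + M), forall e a,
    Q a e <-> sat (scons a (fun n => ev (s n) e)) phi.
Proof.
  move=> [phi [s Hs]].
  (* Several indices may stand for the quantified variable: those with [s n = inl 0] are merged into
     index 0, the others move up by one. *)
  exists (rename (fun n => match s n with inl 0 => 0 | _ => S n end) phi),
    (fun n => match s n with inl (S i) => inl i | t => t end) => e a.
  rewrite (Hs (scons a e)); symmetry; apply: sat_rename => n.
  by case E: (s n) => [[|i]|c] /=; rewrite ?E.
Qed.

Lemma dfn_all (Q : M -> (nat -> M) -> Prop) :
  dfn (fun e => Q (e 0) (fun n => e (S n))) -> dfn (fun e => forall a, Q a e).
Proof.
  move=> /dfn_quantifier[phi [s H]]; exists (fAll phi), s => e /=.
  by split=> K a; apply/H.
Qed.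

Lemma dfn_ex (Q : M -> (nat -> M) -> Prop) :
  dfn (fun e => Q (e 0) (fun n => e (S n))) -> dfn (fun e => exists a, Q a e).
Proof.
  move=> /dfn_quantifier[phi [s H]]; exists (fEx phi), s => e /=.
  by split=> -[a K]; exists a; apply/H.
Qed.

Lemma dfn_subst P (s : nat -> nat + M) :
  dfn P -> dfn (fun e => P (fun n => ev (s n) e)).
Proof.
  move=> [phi [s' H]].
  exists phi, (fun n => match s' n with inl i => s i | t => t end) => e.
  by rewrite H; apply: sat_ext => n; case: (s' n).
Qed.

Lemma dfn_app1 (R : M -> Prop) t : dfn1 R -> term t -> dfn (fun e => R (t e)).
Proof.
  move=> dR [s Hs]; move: (dfn_subst (fun _ => s) dR).
  by apply: dfn_iff_of => e; rewrite Hs.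
Qed.

Lemma dfn_app2 (R : M -> M -> Prop) t u :
  dfn2 R -> term t -> term u -> dfn (fun e => R (t e) (u e)).
Proof.
  move=> dR [s Hs] [s' Hs'].
  move: (dfn_subst (fun n => match n with 0 => s | _ => s' end) dR).
  by apply: dfn_iff_of => e; rewrite Hs Hs'.
Qed.

Lemma dfn_app3 (R : M -> M -> M -> Prop) t u v :
  dfn3 R -> term t -> term u -> term v -> dfn (fun e => R (t e) (u e) (v e)).
Proof.
  move=> dR [s Hs] [s' Hs'] [s'' Hs''].
  move: (dfn_subst (fun n => match n with 0 => s | 1 => s' | _ => s'' end) dR).
  by apply: dfn_iff_of => e; rewrite Hs Hs' Hs''.
Qed.

Lemma dfn_exists_unique (Q : M -> (nat -> M) -> Prop) :
  dfn (fun e => Q (e 0) (fun n => e (S n))) ->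
  dfn (fun e => exists! a, Q a e).
Proof.
  move=> dQ; apply: dfn_ex; apply: dfn_and => //.
  apply: dfn_all; apply: dfn_imp; last by apply: dfn_eq; apply: term_var.
  (* Entry 1 is the witness, which the second copy of [Q] does not mention, hence the shift by
     two. *)
  exact: (dfn_subst (fun n => match n with 0 => inl 0 | S k => inl (S (S k)) end) dQ).
Qed.

(* Class finiteness and countability, so that definable classes need not be
   turned into sets by hand. *)
Definition realizes (a : M) (P : M -> Prop) : Prop := forall z, z ∈ a <-> P z.
Definition fin (P : M -> Prop) : Prop := exists a, realizes a P /\ finite a.
Definition cnt (P : M -> Prop) : Prop := exists a, realizes a P /\ countable a.

End Definability.

(* Automatic proofs of definability *)
Create HintDb dfn.

Ltac solve_term :=
  solve [ repeat lazymatch goal with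
          | |- term (fun e => e _) => apply term_var
          | |- term (fun e => ?t (fun n => e (@?xi n))) => apply (term_rename (t := t) xi)
          | _ => first [ assumption | apply term_cst ]
          end ].

Ltac solve_dfn :=
  unfold realizes; cbv beta;
  lazymatch goal with
  | |- term _ => solve_term
  | |- dfn (fun e => forall a, _) =>
      (* An implication also matches the pattern of a universal quantifier, so it is tried first. *)
      first [ apply dfn_imp; solve_dfn | apply dfn_all; solve_dfn ]
  | |- dfn (fun e => exists a, _) => apply dfn_ex; solve_dfn
  | |- dfn (fun e => exists! a, _) => apply dfn_exists_unique; solve_dfn
  | |- dfn (fun e => _ /\ _) => apply dfn_and; solve_dfn
  | |- dfn (fun e => _ \/ _) => apply dfn_or; solve_dfn
  | |- dfn (fun e => ~ _) => apply dfn_not; solve_dfn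
  | |- dfn (fun e => _ <-> _) => apply dfn_iff; solve_dfn
  | |- dfn (fun e => False) => apply dfn_false
  | |- dfn (fun e => _ ∈ _) => apply dfn_mem; solve_term
  | |- dfn (fun e => _ = _) => apply dfn_eq; solve_term
  | |- _ => first
     [ solve [ auto 2 with dfn nocore ]
     | apply dfn_app1; [ solve [ assumption | auto 2 with dfn nocore ] | solve_term ]
     | apply dfn_app2; [ solve [ assumption | auto 2 with dfn nocore ] | solve_term .. ]
     | apply dfn_app3; [ solve [ assumption | auto 2 with dfn nocore ] | solve_term .. ] ]
  end.

(** * Definability of the internal set-theoretic notions *)

Section DefinableNotions.
Context (M : structure).

Lemma dfn_subset : dfn2 (@subset M).
Proof. rewrite /subset; solve_dfn. Qed.
Hint Resolve dfn_subset : dfn.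

Lemma dfn_empty : dfn1 (@empty M).
Proof. rewrite /empty; solve_dfn. Qed.
Hint Resolve dfn_empty : dfn.

Lemma dfn_upair : dfn3 (@is_upair M).
Proof. rewrite /is_upair; solve_dfn. Qed.
Hint Resolve dfn_upair : dfn.

Lemma dfn_opair : dfn3 (@is_opair M).
Proof. rewrite /is_opair; solve_dfn. Qed.
Hint Resolve dfn_opair : dfn.

Lemma dfn_succ : dfn2 (@is_succ M).
Proof. rewrite /is_succ; solve_dfn. Qed.
Hint Resolve dfn_succ : dfn.

Lemma dfn_inductive_set : dfn1 (@inductive_set M).
Proof. rewrite /inductive_set; solve_dfn. Qed.
Hint Resolve dfn_inductive_set : dfn.

Lemma dfn_omega : dfn1 (@is_omega M).
Proof. rewrite /is_omega; solve_dfn. Qed.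
Hint Resolve dfn_omega : dfn.

Lemma dfn_related : dfn3 (@related M).
Proof. rewrite /related; solve_dfn. Qed.
Hint Resolve dfn_related : dfn.

Lemma dfn_relation_between : dfn3 (@relation_between M).
Proof. rewrite /relation_between; solve_dfn. Qed.
Hint Resolve dfn_relation_between : dfn.

Lemma dfn_function : dfn3 (@is_function M).
Proof. rewrite /is_function; solve_dfn. Qed.
Hint Resolve dfn_function : dfn.

Lemma dfn_injection : dfn3 (@is_injection M).
Proof. rewrite /is_injection; solve_dfn. Qed.
Hint Resolve dfn_injection : dfn.

Lemma dfn_bijection : dfn3 (@is_bijection M).
Proof. rewrite /is_bijection; solve_dfn. Qed.
Hint Resolve dfn_bijection : dfn.

Lemma dfn_finite : dfn1 (@finite M).
Proof. rewrite /finite; solve_dfn. Qed.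
Hint Resolve dfn_finite : dfn.

Lemma dfn_countable : dfn1 (@countable M).
Proof. rewrite /countable; solve_dfn. Qed.
Hint Resolve dfn_countable : dfn.

(** [fin] takes a class, not an element, so the application lemmas do not cover it; the variable of
    the class is handled as a bound one. *)
Lemma dfn_fin (Q : M -> (nat -> M) -> Prop) :
  dfn (fun e => Q (e 0) (fun n => e (S n))) ->
  dfn (fun e => fin (fun z => Q z e)).
Proof.
  move=> dQ; rewrite /fin; apply: dfn_ex; apply: dfn_and; last solve_dfn.
  apply: dfn_all; apply: dfn_iff; first solve_dfn.
  exact: (dfn_subst (fun n => match n with 0 => inl 0 | S k => inl (S (S k)) end) dQ).
Qed.

Lemma dfn_cnt (Q : M -> (nat -> M) -> Prop) :
  dfn (fun e => Q (e 0) (fun n => e (S n))) ->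
  dfn (fun e => cnt (fun z => Q z e)).
Proof.
  move=> dQ; rewrite /cnt; apply: dfn_ex; apply: dfn_and; last solve_dfn.
  apply: dfn_all; apply: dfn_iff; first solve_dfn.
  exact: (dfn_subst (fun n => match n with 0 => inl 0 | S k => inl (S (S k)) end) dQ).
Qed.

End DefinableNotions.

#[export] Hint Resolve dfn_subset dfn_empty dfn_upair dfn_opair dfn_succ
  dfn_inductive_set dfn_omega dfn_related dfn_relation_between dfn_function
  dfn_injection dfn_bijection dfn_finite dfn_countable : dfn.
#[export] Hint Extern 1 (dfn (fun e => fin _)) => apply dfn_fin; solve_dfn : dfn.
#[export] Hint Extern 1 (dfn (fun e => cnt _)) => apply dfn_cnt; solve_dfn : dfn.

(** * Sets, ordered pairs and relations inside the model *)

Section SetTheory.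
Context (M : structure) (HZ : ZF M).
Implicit Types (a b c f r w x y z p q n m : M) (P Q : M -> Prop).

Definition adjoins x a y : Prop := forall z, z ∈ y <-> z ∈ x \/ z = a.

Lemma dfn_adjoins : dfn3 adjoins.
Proof. rewrite /adjoins; solve_dfn. Qed.
Hint Resolve dfn_adjoins : dfn.

Lemma set_ext x y : (forall z, z ∈ x <-> z ∈ y) -> x = y.
Proof. exact: ZF_extensionality. Qed.

Lemma realizes_unique a b P : realizes a P -> realizes b P -> a = b.
Proof. by move=> Ha Hb; apply: set_ext => z; rewrite (Ha z) (Hb z). Qed.

Lemma separation P a : dfn1 P -> exists b, realizes b (fun x => x ∈ a /\ P x).
Proof.
  move=> [phi [s H]].
  (* [P] reads only entry 0, so it can be evaluated in the constant environment [x]: every index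
     that carries no parameter denotes [x] and is renamed to 0. *)
  have [b Hb] := ZF_separation HZ
    (rename (fun i => match s i with inl _ => 0 | inr _ => S i end) phi)
    (fun i => match s i with inl _ => a | inr c => c end) a.
  exists b => x; rewrite Hb (H (fun _ => x)).
  split=> -[Ha K]; split => //; move: K; apply sat_rename => i;
    by case E: (s i) => [j|c] /=; rewrite ?E.
Qed.

Lemma realizable P a : dfn1 P -> (forall x, P x -> x ∈ a) -> exists b, realizes b P.
Proof.
  move=> dP H; have [b Hb] := separation a dP.
  exists b => x; rewrite (Hb x); by split=> [[]|Px] //; split; first exact: H.
Qed.

Lemma empty_ex : exists x : M, empty x.
Proof. by have [w [[x [Hx _]] _]] := ZF_infinity HZ; exists x. Qed.

Lemma adjoins_ex x a : exists y, adjoins x a y.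
Proof.
  have [s Hs] := ZF_pairing HZ a a.
  have [p Hp] := ZF_pairing HZ x s.
  have [u Hu] := ZF_union HZ p.
  exists u => z; rewrite Hu; split.
  - move=> [y [/Hp[->|->] Hz]]; first by left.
    by right; move: Hz => /Hs[].
  - case=> [Hz|->]; first by exists x; split => //; apply/Hp; left.
    by exists s; split; [apply/Hp; right|apply/Hs; left].
Qed.

Lemma union2_ex x y : exists u, forall z, z ∈ u <-> z ∈ x \/ z ∈ y.
Proof.
  have [p Hp] := ZF_pairing HZ x y.
  have [u Hu] := ZF_union HZ p.
  exists u => z; rewrite Hu; split.
  - by move=> [v [/Hp[->|->] Hz]]; [left|right].
  - by case=> Hz; [exists x|exists y]; split => //; apply/Hp; [left|right].
Qed.

Lemma mem_irrefl x : ~ x ∈ x.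
Proof.
  have [s Hs] := ZF_pairing HZ x x.
  have [|y [/Hs[->|->] Hy]] := ZF_foundation HZ (x := s).
  - by move=> /(_ x); apply; apply/Hs; left.
  - by move=> /[dup] /Hy H; case: H; apply/Hs; left.
  - by move=> /[dup] /Hy H; case: H; apply/Hs; left.
Qed.

Lemma upair_unique x y p q : is_upair x y p -> is_upair x y q -> p = q.
Proof. move=> Hp Hq; apply: set_ext => z; by rewrite (Hp z) (Hq z). Qed.

Lemma opair_unique x y p q : is_opair x y p -> is_opair x y q -> p = q.
Proof. move=> Hp Hq; apply: set_ext => z; by rewrite (Hp z) (Hq z). Qed.

Lemma opair_ex x y : exists p, is_opair x y p.
Proof.
  have [s Hs] := ZF_pairing HZ x x.
  have [u Hu] := ZF_pairing HZ x y.
  have [p Hp] := ZF_pairing HZ s u.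
  exists p => z; rewrite (Hp z); split.
  - by case=> ->; [left|right].
  - by case=> H; [left|right]; apply: upair_unique; eassumption.
Qed.

Lemma opair_inj x y x' y' p :
  is_opair x y p -> is_opair x' y' p -> x = x' /\ y = y'.
Proof.
  move=> Hp Hp'.
  have [s Hs] := ZF_pairing HZ x x.
  have [u Hu] := ZF_pairing HZ x y.
  have [s' Hs'] := ZF_pairing HZ x' x'.
  have [u' Hu'] := ZF_pairing HZ x' y'.
  have Ex : x = x'.
  { have /Hp'[H|H] : s ∈ p by apply/Hp; left.
    - by have /Hs[] : x' ∈ s by apply/H; left.
    - by have /Hs[] : x' ∈ s by apply/H; left. }
  split=> //; subst x'.
  have Hy : y = x \/ y = y'.
  { have /Hp'[H|H] : u ∈ p by apply/Hp; right.
    - by left; have /H[] : y ∈ u by apply/Hu; right.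
    - by have /H : y ∈ u by apply/Hu; right. }
  have Hy' : y' = x \/ y' = y.
  { have /Hp[H|H] : u' ∈ p by apply/Hp'; right.
    - by left; have /H[] : y' ∈ u' by apply/Hu'; right.
    - by have /H : y' ∈ u' by apply/Hu'; right. }
  by case: Hy; case: Hy' => *; subst.
Qed.

(** Kuratowski pairs of elements of [a] and [b] lie in the double power set of their union, where
    separation cuts out the relation. *)
Lemma relation_ex (R : M -> M -> Prop) a b : dfn2 R ->
  exists r, relation_between r a b /\
    forall x y, related r x y <-> x ∈ a /\ y ∈ b /\ R x y.
Proof.
  move=> dR.
  have [u Hu] := union2_ex a b.
  have [pu Hpu] := ZF_power_set HZ u.
  have [ppu Hppu] := ZF_power_set HZ pu.
  have [|r Hr] := separation (P := fun p => exists x y,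
    x ∈ a /\ y ∈ b /\ is_opair x y p /\ R x y) ppu.
    solve_dfn.
  exists r; split.
    by move=> p /Hr[_ [x [y [? [? [? _]]]]]]; exists x, y.
  move=> x y; split.
  - move=> [p [Hp /Hr[_ [x' [y' [? [? [Hp' ?]]]]]]]].
    by have [-> ->] := opair_inj Hp Hp'.
  - move=> [Hx [Hy Rxy]]; have [p Hp] := opair_ex x y.
    exists p; split => //; apply/Hr; split; last by exists x, y.
    apply/Hppu => s Hs; apply/Hpu => z.
    by move: Hs => /Hp[] Hs /Hs[->|->]; apply/Hu; auto.
Qed.

Lemma relation_set_ext r q a b :
  relation_between r a b -> relation_between q a b ->
  (forall x y, x ∈ a -> y ∈ b -> related r x y <-> related q x y) -> r = q.
Proof.
  move=> Hr Hq H; apply: set_ext => p; split => Hp.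
  - have [x [y [Hx [Hy Op]]]] := Hr _ Hp.
    have /H : related r x y by exists p.
    move=> /(_ Hx Hy) [p' [Op' Hp']]; by rewrite (opair_unique Op Op').
  - have [x [y [Hx [Hy Op]]]] := Hq _ Hp.
    have /(H _ _ Hx Hy) : related q x y by exists p.
    move=> [p' [Op' Hp']]; by rewrite (opair_unique Op Op').
Qed.

Lemma related_mem r a b x y : relation_between r a b -> related r x y -> x ∈ a /\ y ∈ b.
Proof.
  move=> Hr [p [Hp /Hr[x' [y' [? [? Hp']]]]]].
  by have [-> ->] := opair_inj Hp Hp'.
Qed.

Lemma functional f a b x y y' : is_function f a b ->
  related f x y -> related f x y' -> y = y'.
Proof.
  move=> [Rf Tf] H H'; have [/Tf[v [_ U]] _] := related_mem Rf H.
  by rewrite -(U _ H) (U _ H').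
Qed.

Lemma injection_of (R : M -> M -> Prop) a b : dfn2 R ->
  (forall x, x ∈ a -> exists y, y ∈ b /\ R x y) ->
  (forall x y y', x ∈ a -> y ∈ b -> y' ∈ b -> R x y -> R x y' -> y = y') ->
  (forall x x' y, x ∈ a -> x' ∈ a -> y ∈ b -> R x y -> R x' y -> x = x') ->
  exists f, is_injection f a b /\
    forall x y, related f x y <-> x ∈ a /\ y ∈ b /\ R x y.
Proof.
  move=> dR T F I; have [f [Rf Hf]] := relation_ex a b dR.
  exists f; split => //; split; first split => //.
  - move=> x Hx; have [y [Hy Rxy]] := T _ Hx.
    exists y; split; first by apply/Hf.
    by move=> y' /Hf[_ [Hy' Rxy']]; apply: F Rxy Rxy'.
  - by move=> x x' y /Hf[Hx [Hy R1]] /Hf[Hx' [_ R2]]; apply: I R1 R2.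
Qed.

(** * The natural numbers *)

(** The intersection of all inductive sets, cut out of the one given by infinity. Each inductive set
    contains its own empty set and successors, which extensionality identifies. *)
Lemma omega_ex : exists w : M, is_omega w.
Proof.
  have [w0 Hw0] := ZF_infinity HZ.
  have [|w Hw] := separation (P := fun x => forall v, inductive_set v -> x ∈ v) w0.
    solve_dfn.
  exists w; split; last by move=> v Hv x /Hw[_ H]; apply: H.
  have empty_unique x y : empty x -> empty y -> x = y.
    by move=> Hx Hy; apply: set_ext => z; split=> [/Hx|/Hy].
  have succ_unique x y z : is_succ x y -> is_succ x z -> y = z.
    by move=> Hy Hz; apply: set_ext => u; rewrite (Hy u) (Hz u).
  split.
  - have [[e [He Hin]] _] := Hw0.
    exists e; split => //; apply/Hw; split => // v [[e' [He' Hin']] _].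
    by rewrite (empty_unique e e').
  - move=> x /Hw[Hx Hall].
    have [s [Hs Hin]] := proj2 Hw0 _ Hx.
    exists s; split => //; apply/Hw; split => // v Hv.
    have [s' [Hs' Hin']] := proj2 Hv _ (Hall _ Hv).
    by rewrite (succ_unique _ _ _ Hs Hs').
Qed.

(** The elements of [w] satisfying [P] form a set by separation, and this set is inductive.
    Definability matters: ω of the model may be nonstandard, so Rocq induction on numbers cannot
    replace this. *)
Lemma omega_ind w P : is_omega w -> dfn1 P ->
  (forall x, empty x -> P x) ->
  (forall x y, x ∈ w -> P x -> is_succ x y -> P y) ->
  forall x, x ∈ w -> P x.
Proof.
  move=> [Iw Lw] dP H0 HS.
  have [v Hv] := separation w dP.
  suff Iv : inductive_set v by move=> x /(Lw _ Iv)/Hv[].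
  split.
  - have [[e [He Hin]] _] := Iw.
    by exists e; split => //; apply/Hv; split => //; apply: H0.
  - move=> x /Hv[Hx Px]; have [s [Hs Hin]] := proj2 Iw _ Hx.
    by exists s; split => //; apply/Hv; split => //; apply: HS Hs.
Qed.

Lemma omega_unique w w' : is_omega w -> is_omega w' -> w = w'.
Proof. by move=> [I L] [I' L']; apply: set_ext => x; split; [apply: L|apply: L']. Qed.

Lemma omega_transitive w n m : is_omega w -> n ∈ w -> m ∈ n -> m ∈ w.
Proof.
  move=> Hw Hn; move: n Hn m.
  apply: (omega_ind Hw); first solve_dfn.
  - by move=> x Hx m /Hx.
  - by move=> x y Hx IH Hy m /Hy[/IH|->].
Qed.

Lemma nat_transitive w n m k : is_omega w -> n ∈ w -> m ∈ n -> k ∈ m -> k ∈ n.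
Proof.
  move=> Hw Hn; move: n Hn m k.
  apply: (omega_ind Hw); first solve_dfn.
  - by move=> x Hx m k /Hx.
  - move=> x y Hx IH Hy m k /Hy[Hm Hk|-> Hk]; apply/Hy; left => //.
    exact: IH Hk.
Qed.

(** Inclusion serves as the order of ω throughout; this turns it back into equality or
    membership. *)
Lemma nat_subset_cases w n m : is_omega w -> n ∈ w -> m ∈ w ->
  subset m n -> m = n \/ m ∈ n.
Proof.
  move=> Hw Hn Hm; move: n Hn.
  apply: (omega_ind Hw); first solve_dfn.
  - move=> x Hx H; left; apply: set_ext => z; by split=> [/H|/Hx].
  - move=> x y Hx IH Hy H.
    case: (classic (x ∈ m)) => Hxm.
    + left; apply: set_ext => z; split; first exact: H.
      by move=> /Hy[Hz|-> //]; apply: nat_transitive Hw Hm Hxm Hz.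
    + right; apply/Hy; suff /IH[]: subset m x by [right|left].
      by move=> z /[dup] Hz /H/Hy[//|E]; rewrite -E in Hxm.
Qed.

Lemma nat_total w n m : is_omega w -> n ∈ w -> m ∈ w -> subset n m \/ subset m n.
Proof.
  move=> Hw Hn Hm; move: n Hn.
  apply: (omega_ind Hw); first solve_dfn.
  - by move=> x Hx; left => z /Hx.
  - move=> x y Hx IH Hy.
    have xy : subset x y by move=> z Hz; apply/Hy; left.
    case: IH => H; last by right => z /H/xy.
    case: (nat_subset_cases Hw Hm Hx H) => [E|Hxm]; first by right; rewrite -E.
    by left => z /Hy[/H|->].
Qed.


(** * Finite sets *)

Lemma bijection_of (R : M -> M -> Prop) a b : dfn2 R ->
  (forall x, x ∈ a -> exists y, y ∈ b /\ R x y) ->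
  (forall x y y', x ∈ a -> y ∈ b -> y' ∈ b -> R x y -> R x y' -> y = y') ->
  (forall x x' y, x ∈ a -> x' ∈ a -> y ∈ b -> R x y -> R x' y -> x = x') ->
  (forall y, y ∈ b -> exists x, x ∈ a /\ R x y) ->
  exists f, is_bijection f a b.
Proof.
  move=> dR T F I S; have [f [If Hf]] := injection_of dR T F I.
  exists f; split => // y Hy; have [x [Hx Rxy]] := S _ Hy.
  by exists x; apply/Hf.
Qed.

Lemma finite_empty x : empty x -> finite x.
Proof.
  move=> Hx; have [w Hw] := omega_ex.
  have [e [He Hin]] := proj1 (proj1 Hw).
  have [|||||f Hf] := bijection_of (R := fun _ _ => False) (a := x) (b := e).
  - solve_dfn.
  - by move=> y /Hx.
  - done.
  - done.
  - by move=> y /He.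
  - by exists w, e, f.
Qed.

Lemma adjoins_mem x a y : a ∈ x -> adjoins x a y -> y = x.
Proof. by move=> Ha Hy; apply: set_ext => z; rewrite (Hy z); split; [case=> [|->]|left]. Qed.

Lemma remove_ex x a : exists y, realizes y (fun z => z ∈ x /\ z <> a).
Proof. apply: (separation (P := fun z => z <> a)); solve_dfn. Qed.

Lemma adjoins_remove x a y : a ∈ x ->
  realizes y (fun z => z ∈ x /\ z <> a) -> adjoins y a x.
Proof.
  move=> Ha Hy z; rewrite (Hy z); split; last by case=> [[]|->].
  by case: (classic (z = a)); [right|left].
Qed.

Lemma finite_adjoins x a y : finite x -> adjoins x a y -> finite y.
Proof.
  move=> Fx Hy; case: (classic (a ∈ x)) => Ha; first by rewrite (adjoins_mem Ha Hy).
  have [w [n [f [Hw [Hn [[Ff If] Sf]]]]]] := Fx.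
  have [m [Hm Hmw]] := proj2 (proj1 Hw) _ Hn.
  have Rf := proj1 Ff.
  have Nn : ~ n ∈ n by exact: mem_irrefl.
  (* The new element [a] goes to [n], a value that [f] does not take because [n] is not a member of
     itself. *)
  have [|||||g Hg] := bijection_of (a := y) (b := m)
     (R := fun u v => related f u v \/ (u = a /\ v = n)).
  - solve_dfn.
  - move=> u /Hy[Hu|->]; last by exists n; split; [apply/Hm; right|right].
    have [v [Hv _]] := proj2 Ff _ Hu; exists v; split; last by left.
    by apply/Hm; left; have [] := related_mem Rf Hv.
  - move=> u v v' _ _ _ [H|[-> ->]] [H'|[E ->]] //.
    + exact: functional Ff H H'.
    + by rewrite E in H; have [/Ha] := related_mem Rf H.
    + by have [/Ha] := related_mem Rf H'.
  - move=> u u' v _ _ _ [H|[-> ->]] [H'|[-> E]] //.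
    + exact: If H H'.
    + by rewrite E in H; have [_ /Nn] := related_mem Rf H.
    + by have [_ /Nn] := related_mem Rf H'.
  - move=> v /Hm[/Sf[u Hu]|->].
      by exists u; split; [apply/Hy; left; have [] := related_mem Rf Hu|left].
    by exists a; split; [apply/Hy; right|right].
  - by exists w, m, g.
Qed.

Lemma finite_ind P : dfn1 P ->
  (forall x, empty x -> P x) ->
  (forall x a y, finite x -> P x -> ~ a ∈ x -> adjoins x a y -> P y) ->
  forall x, finite x -> P x.
Proof.
  move=> dP H0 HS x [w [n [f [Hw [Hn Hf]]]]].
  suff H : finite x /\ P x by case: H.
  move: n Hn x f Hf.
  apply: (omega_ind Hw); first solve_dfn.
  - move=> n Hn x f [[[Rf Tf] _] _].
    have Ex : empty x by move=> z /Tf[v [/(related_mem Rf)[_ /Hn]]].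
    by split; [apply: finite_empty|apply: H0].
  - move=> n m Hn IH Hm x f [[Ff If] Sf]; have Rf := proj1 Ff.
    have [|a Ha] := Sf n; first by apply/Hm; right.
    have [Hax _] := related_mem Rf Ha.
    (* [a] is the preimage of [n], the last element of [m]; without it [f] maps onto [n]. *)
    have [x' Hx'] := remove_ex x a.
    have [|||||g Hg] := bijection_of (a := x') (b := n) (R := related f).
    + solve_dfn.
    + move=> u /Hx'[Hu Nu]; have [v [Hv _]] := proj2 Ff _ Hu.
      exists v; split => //; have [_ /Hm[//|E]] := related_mem Rf Hv.
      by case: Nu; apply: If Ha; rewrite -E.
    + by move=> u v v' _ _ _; apply: functional Ff.
    + by move=> u u' v _ _ _; apply: If.
    + move=> v Hv; have [|u Hu] := Sf v; first by apply/Hm; left.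
      exists u; split => //; apply/Hx'; have [Hux _] := related_mem Rf Hu.
      split => // E; rewrite E in Hu; move: Hv; rewrite (functional Ff Hu Ha).
      exact: mem_irrefl.
    + have [Fx' Px'] := IH _ _ Hg.
      have Hadj := adjoins_remove Hax Hx'.
      split; first exact: finite_adjoins Fx' Hadj.
      by apply: HS Fx' Px' _ Hadj => /Hx'[].
Qed.

Lemma finite_subset x y : finite x -> subset y x -> finite y.
Proof.
  move=> Fx; move: x Fx y; apply: finite_ind; first solve_dfn.
  - by move=> x Hx y H; apply: finite_empty => z /H/Hx.
  - move=> x a x' Fx IH Ha Hx' y H.
    have [y' Hy'] := remove_ex y a.
    have Fy' : finite y' by apply: IH => z /Hy'[/H/Hx'[]].
    case: (classic (a ∈ y)) => Hay; first exact: finite_adjoins Fy' (adjoins_remove Hay Hy').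
    by apply: IH => z /[dup] Hz /H/Hx'[//|E]; rewrite E in Hz.
Qed.

Lemma fin_set x : finite x -> fin (fun z => z ∈ x).
Proof. by exists x. Qed.

Lemma finite_fin x : fin (fun z => z ∈ x) -> finite x.
Proof. by move=> [a [Ha Fa]]; rewrite (set_ext (x := x) (y := a)) // => z; rewrite (Ha z). Qed.

Lemma fin_ext P Q : (forall z, P z <-> Q z) -> fin P -> fin Q.
Proof. by move=> H [a [Ha Fa]]; exists a; split => // z; rewrite (Ha z). Qed.

Lemma fin_sub P Q : dfn1 Q -> fin P -> (forall z, Q z -> P z) -> fin Q.
Proof.
  move=> dQ [a [Ha Fa]] H.
  have [|b Hb] := realizable (a := a) dQ; first by move=> x /H/Ha.
  by exists b; split => //; apply: finite_subset Fa _ => z /Hb/H/Ha.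
Qed.

Lemma fin_subsingleton P : (forall x y, P x -> P y -> x = y) -> fin P.
Proof.
  move=> H; have [e He] := empty_ex.
  case: (classic (exists x, P x)) => [[x Px]|N].
  - have [s Hs] := adjoins_ex e x.
    exists s; split; last exact: finite_adjoins (finite_empty He) Hs.
    move=> z; rewrite (Hs z); split; first by case=> [/He|->].
    by move=> Pz; right; apply: H.
  - exists e; split; last exact: finite_empty.
    by move=> z; split=> [/He//|Pz]; case: N; exists z.
Qed.

Lemma fin_or P Q : fin P -> fin Q -> fin (fun z => P z \/ Q z).
Proof.
  move=> [x [Hx Fx]] [y [Hy Fy]].
  suff [u [Hu Fu]] : fin (fun z => z ∈ x \/ z ∈ y).
    by exists u; split => // z; rewrite (Hu z) (Hx z) (Hy z).
  move: x Fx {Hx}; apply: finite_ind; first solve_dfn.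
  - by move=> x Hx; exists y; split => // z; split=> [|[/Hx|]//]; right.
  - move=> x a x' _ [u [Hu Fu]] _ Hx'.
    have [u' Hu'] := adjoins_ex u a.
    exists u'; split; last exact: finite_adjoins Fu Hu'.
    move=> z; rewrite (Hu' z) (Hu z) (Hx' z); tauto.
Qed.

(** Induction on the finite index set, so no choice is involved. *)
Lemma fin_bigcup (R : M -> M -> Prop) P : dfn2 R -> fin P ->
  (forall x, P x -> fin (R x)) -> fin (fun y => exists x, P x /\ R x y).
Proof.
  move=> dR [x [Hx Fx]] H.
  suff : fin (fun y => exists z, z ∈ x /\ R z y).
    apply: fin_ext => z; split=> -[v [/Hx Hv Rvz]]; by exists v.
  have {}H : forall z, z ∈ x -> fin (R z) by move=> z /Hx/H.
  move: x Fx H {Hx}; apply: finite_ind.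
  - apply: dfn_imp; last solve_dfn.
    apply: dfn_all; apply: dfn_imp; first solve_dfn.
    solve_dfn.
  - move=> x Hx _; apply: fin_subsingleton => y y' [z [/Hx]] //.
  - move=> x a x' _ IH _ Hx' H.
    suff : fin (fun y => (exists z, z ∈ x /\ R z y) \/ R a y).
    { apply: fin_ext => y; split.
      + case=> [[z [Hz Rz]]|Ra]; first by exists z; split => //; apply/Hx'; left.
        by exists a; split => //; apply/Hx'; right.
      + by move=> [z [/Hx'[Hz|->] Rz]]; [left; exists z|right]. }
    apply: fin_or; last by apply: H; apply/Hx'; right.
    by apply: IH => z Hz; apply: H; apply/Hx'; left.
Qed.

(** When [b] is adjoined to a set with minimal element [m], either [m] stays minimal or [R b m]
    holds and [b] is minimal. Reversing [R] yields last elements. *)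
Lemma fin_minimal (R : M -> M -> Prop) P : dfn2 R -> fin P ->
  (forall x, P x -> ~ R x x) ->
  (forall x y z, P x -> P y -> P z -> R x y -> R y z -> R x z) ->
  (exists x, P x) -> exists m, P m /\ forall x, P x -> ~ R x m.
Proof.
  move=> dR [a [Ha Fa]] I T [u /Ha Hu].
  suff [m [/Ha Hm H]] : exists m, m ∈ a /\ forall x, x ∈ a -> ~ R x m.
    by exists m; split => // x /Ha; apply: H.
  have {}I : forall x, x ∈ a -> ~ R x x by move=> x /Ha/I.
  have {}T : forall x y z, x ∈ a -> y ∈ a -> z ∈ a -> R x y -> R y z -> R x z.
    by move=> x y z /Ha Hx /Ha Hy /Ha; apply: T.
  move: a Fa {Ha} I T u Hu; apply: finite_ind; first solve_dfn.
  - by move=> x Hx _ _ u /Hx.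
  - move=> x b x' _ IH _ Hx' I T u _.
    have xx' z : z ∈ x -> z ∈ x' by move=> ?; apply/Hx'; left.
    have bx' : b ∈ x' by apply/Hx'; right.
    case: (classic (exists v, v ∈ x)) => [[v Hv]|N]; last first.
      exists b; split => // z /Hx'[Hz|->]; last exact: I.
      by case: N; exists z.
    have [||m [Hm Mm]] := IH _ _ v Hv.
    + by move=> z /xx'; apply: I.
    + by move=> y z t /xx' Hy /xx' Hz /xx' Ht; apply: T.
    + case: (classic (R b m)) => Rbm; last first.
      by exists m; split; [apply: xx'|move=> z /Hx'[/Mm|->]].
    exists b; split => // z /Hx'[Hz Rzb|->]; last exact: I.
    by case: (Mm _ Hz); apply: T Rzb Rbm; auto.
Qed.

(** Induction on [x]: bypassing the adjoined element [a] turns [f] into an injection of the smaller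
    set into itself. *)
Lemma pigeonhole x f : finite x -> is_injection f x x ->
  forall y, y ∈ x -> exists u, related f u y.
Proof.
  move=> Fx; move: x Fx f; apply: finite_ind; first solve_dfn.
  - by move=> x Hx f _ y /Hx.
  - move=> x a x' _ IH Ha Hx' f [Ff If].
    have Rf := proj1 Ff.
    have ax' : a ∈ x' by apply/Hx'; right.
    have [b [Hb _]] := proj2 Ff _ ax'.
    have xx' z : z ∈ x -> z ∈ x' by move=> ?; apply/Hx'; left.
    (* [f] with [a] bypassed: the preimage of [a] is sent to [f a] *)
    have [||||g [Ig Hg]] := injection_of (a := x) (b := x)
      (R := fun u v => related f u v \/ (related f u a /\ v = b)).
    + solve_dfn.
    + move=> u Hu; have [v [Hv _]] := proj2 Ff _ (xx' _ Hu).
      have [_ /Hx'[Hvx|E]] := related_mem Rf Hv; first by exists v; auto.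
      rewrite E in Hv; exists b; split; last by auto.
      have [_ /Hx'[//|Eb]] := related_mem Rf Hb.
      by rewrite Eb in Hb; rewrite -(If _ _ _ Hv Hb) in Ha.
    + move=> u v v' _ Hv Hv' [H|[H ->]] [H'|[H' ->]] //.
      * exact: functional Ff H H'.
      * by rewrite (functional Ff H H') in Hv.
      * by rewrite (functional Ff H' H) in Hv'.
    + move=> u u' v Hu Hu' Hv [H|[H E]] [H'|[H' E']].
      * exact: If H H'.
      * by rewrite E' in H; rewrite (If _ _ _ H Hb) in Hu.
      * by rewrite E in H'; rewrite (If _ _ _ H' Hb) in Hu'.
      * exact: If H H'.
    + have onto y : y ∈ x -> exists u, related f u y.
      move=> /(IH _ Ig)[u /Hg[_ [_ [H|[_ ->]]]]]; by [exists u|exists a].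
    move=> y /Hx'[/onto//|->].
    (* For [a] itself: if its image [b] lies in [x], then the preimage of [b] under [g] can only be
       an element that [f] sends to [a]; otherwise [b] is [a]. *)
    have [_ /Hx'[/[dup] Hbx /(IH _ Ig)[u /Hg[Hu [_ [H|[H _]]]]]|E]] := related_mem Rf Hb.
      * by rewrite (If _ _ _ H Hb) in Hu.
      * by exists u.
      * by exists a; rewrite -{2}E.
Qed.

(** * Cardinalities of finite classes *)

Definition card P n : Prop :=
  exists b w f, realizes b P /\ is_omega w /\ n ∈ w /\ is_bijection f b n.

Lemma dfn_card (Q : M -> (nat -> M) -> Prop) t :
  dfn (fun e => Q (e 0) (fun i => e (S i))) -> term t ->
  dfn (fun e => card (fun z => Q z e) (t e)).
Proof.
  move=> dQ dt; rewrite /card; apply: dfn_ex; apply: dfn_ex; apply: dfn_ex.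
  apply: dfn_and; last solve_dfn.
  apply: dfn_all; apply: dfn_iff; first solve_dfn.
  (* Entry 0 is the element of the class and entries 1 to 3 are [f], [w] and [b], so the outer
     variables start at 4. *)
  exact: (dfn_subst (fun i => match i with 0 => inl 0 | S k => inl (4 + k) end) dQ).
Qed.
Hint Extern 1 (dfn (fun e => card _ _)) => apply dfn_card; solve_dfn : dfn.

Lemma card_ex P : fin P -> exists n, card P n.
Proof. by move=> [b [Hb [w [n [f [Hw [Hn Hf]]]]]]]; exists n, b, w, f. Qed.

(** Sending an element of [Q] to the element of [P] with the same number injects [Q] into itself. By
    the pigeonhole principle this is onto, and all its values lie in [P]. *)
Lemma card_proper P Q n : card P n -> card Q n ->
  (forall z, P z -> Q z) -> forall z, Q z -> P z.
Proof.
  move=> [b [w [f [Hb [Hw [Hn [[Ff If] Sf]]]]]]] [c [w' [g [Hc [Hw' [_ Bg]]]]]] PQ.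
  have [[Fg Ig] Sg] := Bg.
  have Rf := proj1 Ff.
  have [||||h [Ih Hh]] := injection_of (a := c) (b := c)
    (R := fun u v => exists k, related g u k /\ related f v k).
  - solve_dfn.
  - move=> u Hu; have [k [Hk _]] := proj2 Fg _ Hu.
    have [v Hv] := Sf _ (proj2 (related_mem (proj1 Fg) Hk)).
    exists v; split; last by exists k.
    by apply/Hc; apply: PQ; apply/Hb; have [] := related_mem Rf Hv.
  - move=> u v v' _ _ _ [k [Hk H]] [k' [Hk' H']].
    by rewrite (functional Fg Hk Hk') in H; apply: If H H'.
  - move=> u u' v _ _ _ [k [Hk H]] [k' [Hk' H']].
    by rewrite (functional Ff H H') in Hk; apply: Ig Hk Hk'.
  - have Fc : finite c by exists w, n, g.
  move=> z /Hc/(pigeonhole Fc Ih)[u /Hh[_ [_ [k [_ H]]]]].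
  by apply/Hb; have [] := related_mem Rf H.
Qed.

Lemma card_nat w n : is_omega w -> n ∈ w -> card (fun z => z ∈ n) n.
Proof.
  move=> Hw Hn.
  have [|||||h Hh] := bijection_of (R := fun u v => u = v) (a := n) (b := n).
  - solve_dfn.
  - by move=> x Hx; exists x.
  - by move=> x y y' _ _ _ <-.
  - by move=> x y y' _ _ _ ->.
  - by move=> x Hx; exists x.
  - by exists n, w, h.
Qed.

Lemma finite_nat w n : is_omega w -> n ∈ w -> finite n.
Proof.
  move=> Hw Hn; have [b [w' [f [Hb H]]]] := card_nat Hw Hn.
  by apply: finite_fin; exists b; split => //; exists w', n, f.
Qed.

(** Composing the bijections gives [n] the size [m], which is also the size of [m]; one of the two
    numbers includes the other, and [card_proper] makes them equal. *)
Lemma card_unique P n m : card P n -> card P m -> n = m.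
Proof.
  move=> [b [w [f [Hb [Hw [Hn [[Ff If] Sf]]]]]]] [c [w' [g [Hc [Hw' [Hm [[Fg Ig] Sg]]]]]]].
  rewrite -(omega_unique Hw Hw') in Hm.
  rewrite -(realizes_unique Hb Hc) in Fg Ig Sg.
  have card_nm : card (fun z => z ∈ n) m.
  { have [|||||h Hh] := bijection_of (a := n) (b := m)
      (R := fun u v => exists k, related f k u /\ related g k v).
    - solve_dfn.
    - move=> u /Sf[k Hk]; have [Hkb _] := related_mem (proj1 Ff) Hk.
      have [v [Hv _]] := proj2 Fg _ Hkb.
      by exists v; split; [have [] := related_mem (proj1 Fg) Hv|exists k].
    - move=> u v v' _ _ _ [k [Hk H]] [k' [Hk' H']].
      by rewrite (If _ _ _ Hk Hk') in H; apply: functional Fg H H'.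
    - move=> u u' v _ _ _ [k [Hk H]] [k' [Hk' H']].
      by rewrite (Ig _ _ _ H H') in Hk; apply: functional Ff Hk Hk'.
    - move=> v /Sg[k Hk]; have [Hkb _] := related_mem (proj1 Fg) Hk.
      have [u [Hu _]] := proj2 Ff _ Hkb.
      by exists u; split; [have [] := related_mem (proj1 Ff) Hu|exists k].
    - by exists n, w, h. }
  have card_mm := card_nat Hw Hm.
  case: (nat_total Hw Hn Hm) => H.
  - by apply: set_ext => z; split; [apply: H|apply: card_proper card_nm card_mm H z].
  - by apply: set_ext => z; split; [apply: card_proper card_mm card_nm H z|apply: H].
Qed.

(** * Amorphous sets *)

Definition transitive_on P (R : M -> M -> Prop) : Prop :=
  forall x y z, P x -> P y -> P z -> R x y -> R y z -> R x z.
Definition total_on P (R : M -> M -> Prop) : Prop :=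
  forall x y, P x -> P y -> R x y \/ R y x.
Definition antisymmetric_on P (R : M -> M -> Prop) : Prop :=
  forall x y, P x -> P y -> R x y -> R y x -> x = y.
Definition finite_segments P (R : M -> M -> Prop) : Prop :=
  forall x, P x -> fin (fun y => P y /\ R y x).

(** A class rather than a pair of pieces, so that it cuts every set including [b] as well. *)
Definition split_infinite b : Prop :=
  exists E : M -> Prop, dfn1 E /\
    ~ fin (fun z => z ∈ b /\ E z) /\ ~ fin (fun z => z ∈ b /\ ~ E z).

(* The classes of the preorder are ordered like ω; [E] collects every other one. *)
Lemma split_of_preorder b (R : M -> M -> Prop) : dfn2 R -> infinite b ->
  transitive_on (fun x => x ∈ b) R -> total_on (fun x => x ∈ b) R ->
  finite_segments (fun x => x ∈ b) R -> split_infinite b.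
Proof.
  move=> dR Ib T C F.
  have refl x : x ∈ b -> R x x by move=> Hx; case: (C x x Hx Hx).
  have least Q : dfn1 Q -> (exists x, x ∈ b /\ Q x) ->
      exists m, m ∈ b /\ Q m /\ forall x, x ∈ b -> Q x -> R m x.
  { move=> dQ [x0 [Hx0 Qx0]].
    (* Only the finite segment below [x0] is searched; as [R] is total, [~ R x y] says that [y] is
       strictly below [x]. *)
    have [|||||m [[Hm [Qm Rm]] Mm]] := fin_minimal (R := fun y x => ~ R x y)
      (P := fun y => y ∈ b /\ Q y /\ R y x0).
    - solve_dfn.
    - apply: fin_sub (F _ Hx0) _; first solve_dfn.
      by move=> z [? []].
    - by move=> x [Hx _] H; apply: H; apply: refl.
    - move=> x y z [Hx _] [Hy _] [Hz _] Nyx Nzy Rzx.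
      by case: (C x y Hx Hy) => // Rxy; apply: Nzy; apply: T Rzx Rxy.
    - by exists x0; split => //; split => //; apply: refl.
    - exists m; split => //; split => // x Hx Qx.
      case: (C x x0 Hx Hx0) => H; last exact: T Rm H.
      by apply: NNPP => N; apply: (Mm x). }
  (* The class of [y] immediately follows that of [x]: it is strictly above, with nothing in
     between. *)
  pose next x y := x ∈ b /\ y ∈ b /\ ~ R y x /\ forall z, z ∈ b -> R z x \/ R y z.
  have dnext : dfn2 next by rewrite /next; solve_dfn.
  (* If nothing were strictly above [x], the whole of [b] would be the finite segment below [x]. *)
  have next_ex x : x ∈ b -> exists y, next x y.
  { move=> Hx; have [||y [Hy [Ny My]]] := least (fun y => ~ R y x).
    - solve_dfn.
    - apply: NNPP => N; apply: Ib; apply: finite_fin.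
      apply: fin_ext (F _ Hx) => z; split=> [[]//|Hz]; split => //.
      by apply: NNPP => Nz; apply: N; exists z.
    - exists y; split => //; split => //; split => // z Hz.
      by case: (classic (R z x)); [left|right; apply: My]. }
  have pred_ex x : x ∈ b -> (exists z, z ∈ b /\ ~ R x z) -> exists p, next p x.
  { move=> Hx [z [Hz Nz]].
    (* The relation is reversed here: [p] is a greatest element strictly below [x]. *)
    have [|||||p [[Hp Np] Mp]] := fin_minimal (R := fun y x => ~ R y x)
      (P := fun y => y ∈ b /\ ~ R x y).
    - solve_dfn.
    - apply: fin_sub (F _ Hx) _; first solve_dfn.
      by move=> y [Hy Ny]; split => //; case: (C x y Hx Hy).
    - by move=> y [Hy _] H; apply: H; apply: refl.
    - move=> u v t [Hu _] [Hv _] [Ht _] Nuv Nvt Rut.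
      case: (C v u Hv Hu) => // Rvu; apply: Nvt; exact: T Rvu Rut.
    - by exists z.
    - exists p; split => //; split => //; split => // y Hy.
      case: (classic (R x y)) => Rxy; [by right|left].
      by apply: NNPP => N; apply: (Mp y). }
  have next_inj x x' y : next x y -> next x' y -> R x x'.
  { move=> [Hx [Hy [N _]]] [_ [_ [_ H]]].
    by case: (H _ Hx) => // /N. }
  have next_equiv x y y' : next x y -> y' ∈ b -> R y y' -> R y' y -> next x y'.
  { move=> [Hx [Hy [N H]]] Hy' R1 R2; split => //; split => //; split.
    - by move=> Q; apply: N; apply: T R1 Q.
    - move=> z Hz; case: (H z Hz) => H'; [by left|right].
      exact: T R2 H'. }
  (* [E] consists of the even classes: it contains the least elements and is generated by double
     steps of [next]. Quantifying over sets [v] keeps it first-order. *)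
  pose closed v := (forall m, m ∈ b -> (forall x, x ∈ b -> R m x) -> m ∈ v) /\
    (forall x y z, x ∈ v -> next x y -> next y z -> z ∈ v).
  pose E x := x ∈ b /\ forall v, closed v -> x ∈ v.
  have dE : dfn1 E by rewrite /E /closed; solve_dfn.
  have E0 m : m ∈ b -> (forall x, x ∈ b -> R m x) -> E m.
    by move=> Hm Lm; split => // v [H _]; apply: H.
  have E2 x y z : E x -> next x y -> next y z -> E z.
  { move=> [Hx Ex] Nxy Nyz; split; first by case: Nyz => _ [].
    by move=> v /[dup] /Ex Hxv [_ H]; apply: H Nxy Nyz. }
  have E_ind V : dfn1 V ->
      (forall m, m ∈ b -> (forall x, x ∈ b -> R m x) -> V m) ->
      (forall x y z, E x -> V x -> next x y -> next y z -> V z) ->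
      forall x, E x -> V x.
  { move=> dV V0 V2.
    have [|v Hv] := separation (P := fun x => E x /\ V x) b; first solve_dfn.
    suff Cv : closed v by move=> x [_ /(_ v Cv)/Hv[_ []]].
    split.
    - by move=> m Hm Lm; apply/Hv; split; [|split; [apply: E0|apply: V0]].
    - move=> x y z /Hv[Hx [Ex Vx]] Nxy Nyz.
      have Ez := E2 _ _ _ Ex Nxy Nyz.
      by apply/Hv; split; [case: Ez|split; [|apply: V2 Ex Vx Nxy Nyz]]. }
  have alt1 x y : next x y -> E x -> ~ E y.
  { suff H u : E u -> E u /\ forall v, next u v -> ~ E v by move=> Nxy /H[_]; apply.
    move: u; apply: (E_ind); first solve_dfn.
    - move=> m Hm Lm; split; first exact: E0.
      move=> y' Nmy Ey.
      (* A second induction: an even element equivalent to [y'] is not least, since [y'] is above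
         [m]; and if it is two steps above some [u], the middle element is at most [m], hence not
         above [u]. *)
      suff H z : E z -> ~ (R z y' /\ R y' z).
        by apply: (H y' Ey); split; apply: refl; case: Ey.
      have [_ [Hy [NRy _]]] := Nmy.
      move: z; apply: (E_ind); first solve_dfn.
      + move=> m' Hm' Lm' [_ H]; apply: NRy; apply: T H _ => //; exact: Lm'.
      + move=> u w z Eu _ Nuw Nwz [H1 H2].
        have [Hu [Hw [NRw _]]] := Nuw; have [_ [Hz _]] := Nwz.
        have Rwm := next_inj _ _ _ (next_equiv _ _ _ Nwz Hy H1 H2) Nmy.
        by apply: NRw; apply: T Rwm (Lm _ Hu).
    - move=> x' y' z' Ex [_ Vx] Nxy Nyz; split; first exact: E2 Ex Nxy Nyz.
      move=> t Nzt Et.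
      (* Likewise, if an even element equivalent to [t] is two steps above an even [u], then [u] is
         equivalent to [y'] and follows [x'], against the induction hypothesis. *)
      suff H u : E u -> ~ (R u t /\ R t u).
        by apply: (H t Et); split; apply: refl; case: Et.
      have [Hz [Ht [NRt _]]] := Nzt.
      move: u; apply: (E_ind); first solve_dfn.
      + move=> m' Hm' Lm' [_ H]; apply: NRt; apply: T H _ => //; exact: Lm'.
      + move=> u w t' Eu _ Nuw Nwt [H1 H2].
        have [Hu [Hw [NRw _]]] := Nuw; have [_ [Ht' _]] := Nwt.
        have Nwt' := next_equiv _ _ _ Nwt Ht H1 H2.
        have Nuz := next_equiv _ _ _ Nuw Hz
          (next_inj _ _ _ Nwt' Nzt) (next_inj _ _ _ Nzt Nwt').
        have Nxu := next_equiv _ _ _ Nxy Hu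
          (next_inj _ _ _ Nyz Nuz) (next_inj _ _ _ Nuz Nyz).
        exact: Vx Nxu Eu. }
  have alt2 x y : next x y -> ~ E x -> E y.
  { move=> Nxy Ex; apply: NNPP => Ey.
    (* Take a least [q] outside [E] with a successor outside [E]. Its predecessor is in [E], which
       puts [y'] in [E], or is a smaller counterexample. *)
    have [||q [Hq [[Eq [y' [Nqy Ey']]] Lq]]] :=
      least (fun x => ~ E x /\ exists y, next x y /\ ~ E y).
    - solve_dfn.
    - exists x; split; first by case: Nxy.
      by split => //; exists y.
    - have [|p Npq] := pred_ex q Hq.
      + apply: NNPP => N; apply: Eq; apply: E0 => // z Hz.
        by apply: NNPP => Nz; apply: N; exists z.
      + have [Hp [_ [NR _]]] := Npq.
        case: (classic (E p)) => Ep; first by apply: Ey'; apply: E2 Ep Npq Nqy.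
        by apply: NR; apply: Lq => //; split => //; exists q. }
  (* A finite cofinal class would cover [b] by finitely many finite segments. *)
  have cofinal Q : dfn1 Q -> (forall x, x ∈ b -> exists y, y ∈ b /\ Q y /\ R x y) ->
      ~ fin (fun z => z ∈ b /\ Q z).
  { move=> dQ H FQ; apply: Ib; apply: finite_fin.
    have [|||] := fin_sub (P := fun y => exists x, (x ∈ b /\ Q x) /\ (y ∈ b /\ R y x))
      (Q := fun y => y ∈ b).
    - solve_dfn.
    - apply: (fin_bigcup (R := fun x y => y ∈ b /\ R y x)) => //; first solve_dfn.
      by move=> x [Hx _]; apply: F.
    - by move=> z Hz; have [y [Hy [Qy Rzy]]] := H _ Hz; exists y.
    - by move=> c Hc; exists c. }
  (* Both pieces are cofinal, since of an element and its successor exactly one lies in [E]. *)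
  exists E; split => //; split; apply: cofinal => //; try solve_dfn.
  - move=> x Hx; have [y Nxy] := next_ex x Hx; have [_ [Hy [N _]]] := Nxy.
    case: (classic (E x)) => Ex; first by exists x; split => //; split => //; apply: refl.
    exists y; split => //; split; first exact: alt2 Nxy Ex.
    by case: (C x y Hx Hy).
  - move=> x Hx; have [y Nxy] := next_ex x Hx; have [_ [Hy [N _]]] := Nxy.
    case: (classic (E x)) => Ex; last by exists x; split => //; split => //; apply: refl.
    exists y; split => //; split; first exact: alt1 Nxy Ex.
    by case: (C x y Hx Hy).
Qed.

(* [K x n] bounds the rank of [x] by [n]; the preorder compares the least bounds. *)
Lemma preorder_of_bounds w P (K : M -> M -> Prop) : is_omega w -> dfn1 P -> dfn2 K ->
  (forall x, P x -> exists n, n ∈ w /\ K x n) ->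
  (forall n, n ∈ w -> fin (fun x => P x /\ K x n)) ->
  exists R, dfn2 R /\ transitive_on P R /\ total_on P R /\ finite_segments P R.
Proof.
  move=> Hw dP dK E F.
  (* Every bound of [y] dominates one of [x]: this compares the least bounds without picking
     them. *)
  exists (fun x y => forall n, n ∈ w -> K y n -> exists m, m ∈ w /\ subset m n /\ K x m).
  split; first solve_dfn.
  split; [|split].
  - move=> x y z _ _ _ H1 H2 n Hn Kn.
    have [m [Hm [Smn Km]]] := H2 _ Hn Kn.
    have [k [Hk [Skm Kk]]] := H1 _ Hm Km.
    by exists k; split => //; split => // u /Skm/Smn.
  - move=> x y _ _; apply: NNPP => /not_or_and[N1 N2].
    apply: N1 => n Hn Kn; apply: NNPP => N; apply: N2 => m Hm Km.
    case: (nat_total Hw Hn Hm) => H; first by exists n.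
    by case: N; exists m.
  - move=> y /E[n [Hn Kn]].
    apply: (fin_sub (P := fun x => exists m, (m ∈ n \/ m = n) /\ (m ∈ w /\ P x /\ K x m))).
    + solve_dfn.
    + apply: (fin_bigcup (R := fun m x => m ∈ w /\ P x /\ K x m)); first solve_dfn.
      * apply: fin_or; first exact: fin_set (finite_nat Hw Hn).
        by apply: fin_subsingleton => x z -> ->.
      * move=> m Hm; have Hmw : m ∈ w by case: Hm => [/(omega_transitive Hw Hn)|->].
        by apply: fin_ext (F _ Hmw) => x; tauto.
    + move=> x [Px /(_ _ Hn Kn)[m [Hm [Smn Km]]]]; exists m; split => //.
      by case: (nat_subset_cases Hw Hn Hm Smn); auto.
Qed.

(** Breaking the ties of [R] by [L] gives a linear order [T] with finite initial segments; the size
    of the segment up to [x] is then an injection into ω. *)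
Lemma countable_of_preorder P (L R : M -> M -> Prop) a :
  dfn1 P -> dfn2 L -> dfn2 R -> (forall x, P x -> x ∈ a) ->
  transitive_on P L -> total_on P L -> antisymmetric_on P L ->
  transitive_on P R -> total_on P R -> finite_segments P R -> cnt P.
Proof.
  move=> dP dL dR Pa TL CL AL TR CR FR.
  pose T x y := P x /\ R x y /\ (R y x -> L x y).
  have dT : dfn2 T by rewrite /T; solve_dfn.
  have Ttotal x y : P x -> P y -> T x y \/ T y x.
  { move=> Px Py; rewrite /T.
    move: (CR _ _ Px Py) (CL _ _ Px Py); tauto. }
  have Ttrans x y z : P z -> T x y -> T y z -> T x z.
  { move=> Pz [Px [Rxy Lxy]] [Py [Ryz Lyz]]; split => //; split.
      exact: TR Rxy Ryz.
    move=> Rzx; apply: (TL _ y) => //.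
    - by apply: Lxy; apply: TR Ryz Rzx.
    - by apply: Lyz; apply: TR Rzx Rxy. }
  have Tantisym x y : T x y -> T y x -> x = y.
    by move=> [Px [Rxy Lxy]] [Py [Ryx Lyx]]; apply: AL; auto.
  have Tfin x : P x -> fin (fun y => T y x).
  { move=> Px; apply: fin_sub (FR _ Px) _; first solve_dfn.
    by move=> z [? []]. }
  have [b Hb] := realizable dP Pa.
  have [w Hw] := omega_ex.
  exists b; split => //; exists w.
  have [||||f [If _]] := injection_of (a := b) (b := w)
     (R := fun x n => card (fun y => T y x) n).
  - solve_dfn.
  - move=> x /Hb/Tfin/card_ex[n Hn]; exists n; split => //.
    by have [? [w' [? [_ [Hw' [? _]]]]]] := Hn; rewrite (omega_unique Hw Hw').
  - by move=> x n n' _ _ _; apply: card_unique.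
  - have inj x y n : P x -> P y -> card (fun z => T z x) n -> card (fun z => T z y) n ->
        T x y -> x = y.
    { move=> Px Py Cx Cy Txy; apply: (Tantisym) => //.
      apply: (card_proper Cx Cy); first by move=> z Tzx; apply: Ttrans Tzx Txy.
      by case: (Ttotal _ _ Py Py). }
    move=> x y n /Hb Px /Hb Py _ Cx Cy.
    by case: (Ttotal _ _ Px Py) => H; [|symmetry]; apply: inj H; eassumption.
  - by exists f.
Qed.

(** Stated for a Rocq relation, so that it applies to converse orders and to the lexicographic order
    without coding them as sets. *)
Definition finite_antichains b (L : M -> M -> Prop) : Prop :=
  forall c, subset c b ->
    (forall x y, x ∈ c -> y ∈ c -> x <> y -> ~ (L x y \/ L y x)) -> finite c.

(** If [L x y] with [x <> y], then [y] has all the strict predecessors of [x] and also [x], so the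
    numbers of strict predecessors differ. The elements with a given number thus form an antichain,
    hence a finite set. *)
Lemma split_of_finite_downsets b (L : M -> M -> Prop) : dfn2 L -> infinite b ->
  transitive_on (fun x => x ∈ b) L -> antisymmetric_on (fun x => x ∈ b) L ->
  finite_antichains b L ->
  (forall x, x ∈ b -> fin (fun y => y ∈ b /\ L y x /\ y <> x)) -> split_infinite b.
Proof.
  move=> dL Ib T A AC D.
  have [w Hw] := omega_ex.
  have [||||R [dR [TR [CR FR]]]] := preorder_of_bounds Hw (P := fun x => x ∈ b)
    (K := fun x n => card (fun y => y ∈ b /\ L y x /\ y <> x) n).
  - solve_dfn.
  - solve_dfn.
  - move=> x /D/card_ex[n Hn]; exists n; split => //.
    by have [? [w' [? [_ [Hw' [? _]]]]]] := Hn; rewrite (omega_unique Hw Hw').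
  - move=> n Hn.
    have [|c Hc] := separation
      (P := fun x => card (fun y => y ∈ b /\ L y x /\ y <> x) n) b; first solve_dfn.
    exists c; split => //; apply: AC => [x /Hc[]//|].
    suff H x y : x ∈ c -> y ∈ c -> x <> y -> ~ L x y.
      by move=> x y Hx Hy N [|]; apply: H => // E; apply: N.
    move=> /Hc[Hx Cx] /Hc[Hy Cy] N Lxy.
    suff Dxy z : z ∈ b /\ L z x /\ z <> x -> z ∈ b /\ L z y /\ z <> y.
      by have [_ [_]] := card_proper Cx Cy Dxy (conj Hx (conj Lxy N)).
    move=> [Hz [Lzx Nzx]]; split => //; split; first exact: T Lzx Lxy.
    by move=> E; rewrite E in Lzx; apply: N; apply: A.
  - exact: split_of_preorder TR CR FR.
Qed.

(** The elements with finitely many strict predecessors and those with finitely many strict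
    successors together cover [a]. Both sets are finite, since an infinite one could be split, and
    this makes [a] finite. *)
Lemma amorphous_antichain a (L : M -> M -> Prop) : dfn2 L ->
  amorphous a -> transitive_on (fun x => x ∈ a) L ->
  antisymmetric_on (fun x => x ∈ a) L -> ~ finite_antichains a L.
Proof.
  move=> dL [Ia Na] T A AC.
  have Na' Q : dfn1 Q -> fin (fun z => z ∈ a /\ Q z) \/ fin (fun z => z ∈ a /\ ~ Q z).
  { move=> dQ; apply: NNPP => /not_or_and[N1 N2]; apply: Na.
    have [b Hb] := separation a dQ.
    have [|c Hc] := separation (P := fun z => ~ Q z) a; first solve_dfn.
    exists b, c; split; first split.
    - by move=> z; rewrite (Hb z) (Hc z); split; [case: (classic (Q z)); auto|case=> [[]|[]]].
    - by move=> z [/Hb[_ ?] /Hc[_ ?]].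
    - by split=> F; [apply: N1; exists b|apply: N2; exists c]. }
  (* The order is generalized in order to use both [L] and its converse. *)
  have core (L' : M -> M -> Prop) b : dfn2 L' -> transitive_on (fun x => x ∈ a) L' ->
      antisymmetric_on (fun x => x ∈ a) L' -> finite_antichains a L' ->
      realizes b (fun x => x ∈ a /\ fin (fun y => y ∈ a /\ L' y x /\ y <> x)) -> finite b.
  { move=> dL' T' A' AC' Hb; apply: NNPP => Ib.
    have ba x : x ∈ b -> x ∈ a by move=> /Hb[].
    have [|||||E [dE [N1 N2]]] := split_of_finite_downsets (b := b) dL'.
    - done.
    - by move=> x y z /ba Hx /ba Hy /ba Hz; apply: T'.
    - by move=> x y /ba Hx /ba Hy; apply: A'.
    - by move=> c Hc; apply: AC' => x /Hc/ba.
    - move=> x /Hb[_ H]; apply: fin_sub H _; first solve_dfn.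
      by move=> z [/ba].
    - case: (Na' E dE) => H; [apply: N1|apply: N2]; apply: fin_sub H _; try solve_dfn.
      + by move=> z [/ba].
      + by move=> z [/ba]. }
  have [|b Hb] := separation
    (P := fun x => fin (fun y => y ∈ a /\ L y x /\ y <> x)) a; first solve_dfn.
  have [|c Hc] := separation
    (P := fun x => fin (fun y => y ∈ a /\ L x y /\ y <> x)) a; first solve_dfn.
  have Fb : finite b by apply: core Hb.
  have Fc : finite c.
  { apply: (core (fun x y => L y x)) Hc.
    - solve_dfn.
    - by move=> x y z Hx Hy Hz Lyx Lzy; apply: T Lzy Lyx.
    - by move=> x y Hx Hy Lyx Lxy; apply: A.
    - by move=> d Hd H; apply: AC Hd _ => x y Hx Hy N [?|?]; apply: (H x y); auto. }
  apply: Ia; apply: finite_fin.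
  apply: fin_ext (fin_or (fin_set Fb) (fin_set Fc)) => x; split.
    by case=> [/Hb[]|/Hc[]].
  move=> Hx; rewrite (Hb x) (Hc x).
  have [|H|H] := Na' (fun y => L y x /\ y <> x); first solve_dfn; first by left.
  (* By antisymmetry the strict successors of [x] avoid its strict predecessors. *)
  right; split => //; apply: fin_sub H _; first solve_dfn.
  move=> y [Hy [Lxy N]]; split => // -[Lyx _]; apply: N.
  exact: A Lyx Lxy.
Qed.

(** * Well-orders and countable unions *)

Lemma cnt_sub P Q : dfn1 Q -> cnt P -> (forall z, Q z -> P z) -> cnt Q.
Proof.
  move=> dQ [a [Ha [w [f [Hw [Ff If]]]]]] H.
  have [|b Hb] := realizable (a := a) dQ; first by move=> x /H/Ha.
  have [||||g [Ig _]] := injection_of (a := b) (b := w) (R := related f).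
  - solve_dfn.
  - move=> x /Hb/H/Ha Hx; have [y [Hy _]] := proj2 Ff _ Hx.
    by exists y; split; first by have [] := related_mem (proj1 Ff) Hy.
  - by move=> x y y' _ _ _; apply: functional Ff.
  - by move=> x x' y _ _ _; apply: If.
  - by exists b; split => //; exists w, g.
Qed.

Lemma countable_cnt x : cnt (fun z => z ∈ x) -> countable x.
Proof. by move=> [a [Ha Ca]]; rewrite (set_ext (x := x) (y := a)) // => z; rewrite (Ha z). Qed.

Definition strictly s x y : Prop := related s x y /\ x <> y.

Lemma dfn_strictly : dfn3 strictly.
Proof. rewrite /strictly; solve_dfn. Qed.
Hint Resolve dfn_strictly : dfn.

Section WellOrder.
Context (p s : M) (WO : well_order p s).
Notation lt := (strictly s).

Lemma wo_mem x y : related s x y -> x ∈ p /\ y ∈ p.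
Proof. by case: WO => -[R _] _; apply: related_mem. Qed.

Lemma wo_antisym x y : related s x y -> related s y x -> x = y.
Proof. by case: WO => -[_ [_ [A _]]] _; apply: A. Qed.

Lemma wo_trans x y z : related s x y -> related s y z -> related s x z.
Proof. by case: WO => -[_ [_ [_ T]]] _; apply: T. Qed.

Lemma wo_trichotomy x y : x ∈ p -> y ∈ p -> lt x y \/ x = y \/ lt y x.
Proof.
  case: WO => _ [C _] Hx Hy; case: (classic (x = y)); first by auto.
  by move=> N; case: (C x y Hx Hy) => H; [left|right; right]; split; auto.
Qed.

Lemma lt_trans x y z : lt x y -> lt y z -> lt x z.
Proof.
  move=> [xy Nxy] [yz Nyz]; split; first exact: wo_trans xy yz.
  by move=> E; rewrite -E in yz; apply: Nxy; apply: wo_antisym.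
Qed.

Lemma wo_ind Q : dfn1 Q ->
  (forall x, x ∈ p -> (forall u, lt u x -> Q u) -> Q x) -> forall x, x ∈ p -> Q x.
Proof.
  move=> dQ IH x Hx; apply: NNPP => Nx.
  have [|b Hb] := separation (P := fun x => ~ Q x) p; first solve_dfn.
  have [_ [_ L]] := WO.
  have [||m [/Hb[Hm Qm] Lm]] := L b.
  - by move=> z /Hb[].
  - by move=> /(_ x); apply; apply/Hb.
  - apply: Qm; apply: IH => // u [um N]; apply: NNPP => Qu.
    have [Hu _] := wo_mem um.
    by apply: N; apply: wo_antisym um (Lm _ _); apply/Hb.
Qed.

Lemma wo_least Q : dfn1 Q -> (exists x, x ∈ p /\ Q x) ->
  exists m, m ∈ p /\ Q m /\ forall x, lt x m -> ~ Q x.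
Proof.
  move=> dQ [x [Hx Qx]]; apply: NNPP => N.
  suff : ~ Q x by apply.
  move: x Hx {Qx}; apply: wo_ind; first solve_dfn.
  by move=> x Hx IH Qx; apply: N; exists x.
Qed.

(** * Functions from a well-ordered set to ω, ordered lexicographically *)

Lemma functions_ex w : exists g, realizes g (fun f => is_function f p w).
Proof.
  (* [x = x] always holds, so [t] is the product of [p] and [w]. *)
  have [|t [Rt Ht]] := relation_ex (R := fun x y => x = x) p w; first solve_dfn.
  have [u Hu] := ZF_power_set HZ t.
  apply: (realizable (a := u)); first solve_dfn.
  move=> f [Rf _]; apply/Hu => z /Rf[x [y [Hx [Hy Oz]]]].
  have [z' [Oz' Hz']] : related t x y by apply/Ht; auto.
  by rewrite (opair_unique Oz Oz').
Qed.

(** Inclusion being the order of ω, [subset n m /\ n <> m] says n < m; [x] is the first place of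
    difference. *)
Definition lex f g : Prop := f = g \/ exists x, x ∈ p /\
  (forall u, lt u x -> forall n, related f u n <-> related g u n) /\
  exists n m, related f x n /\ related g x m /\ subset n m /\ n <> m.

Lemma dfn_lex : dfn2 lex.
Proof. rewrite /lex; solve_dfn. Qed.

Lemma lex_total w : is_omega w -> total_on (fun f => is_function f p w) lex.
Proof.
  move=> Hw f g Ff Fg; case: (classic (f = g)) => [->|N]; first by left; left.
  have [||x [Hx [Dx Lx]]] := wo_least
     (Q := fun x => ~ forall n, related f x n <-> related g x n).
  - solve_dfn.
  - apply: NNPP => E; apply: N; apply: relation_set_ext (proj1 Ff) (proj1 Fg) _.
    move=> x n Hx Hn; apply: NNPP => H; apply: E.
    by exists x; split => // /(_ n)/H.
  - have [n [Hn _]] := proj2 Ff _ Hx.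
    have [m [Hm _]] := proj2 Fg _ Hx.
    have Nnm : n <> m.
    { move=> E; apply: Dx => k; rewrite -E in Hm.
      by split=> H; [rewrite (functional Ff H Hn)|rewrite (functional Fg H Hm)]. }
    have [_ Hnw] := related_mem (proj1 Ff) Hn.
    have [_ Hmw] := related_mem (proj1 Fg) Hm.
    have {}Lx u : lt u x -> forall k, related f u k <-> related g u k.
      by move=> /Lx/NNPP.
    case: (nat_total Hw Hnw Hmw) => H; [left|right]; right; exists x; split => //.
    + by split => //; exists n, m.
    + split; first by move=> u /Lx E k; rewrite E.
      by exists m, n; auto.
Qed.

Lemma lex_trans w : is_omega w -> transitive_on (fun f => is_function f p w) lex.
Proof.
  move=> Hw f g h Ff Fg Fh [->//|[x [Hx [Ex [n [m [Hn [Hm [S N]]]]]]]]].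
  move=> [<-|[y [Hy [Ey [k [l [Hk [Hl [S' N']]]]]]]]].
    by right; exists x; split => //; split => //; exists n, m.
  (* The smaller of [x] and [y] is the first place where [f] and [h] differ. *)
  right; case: (wo_trichotomy Hx Hy) => [xy|[E|yx]].
  - exists x; split => //; split.
      by move=> u ux i; rewrite (Ex _ ux) (Ey _ (lt_trans ux xy)).
    by exists n, m; split => //; split => //; apply/Ey.
  - rewrite -E in Hk Hl Ey; rewrite (functional Fg Hk Hm) in S' N'.
    exists x; split => //; split.
      by move=> u ux i; rewrite (Ex _ ux) (Ey _ ux).
    exists n, l; split => //; split => //; split; first by move=> z /S/S'.
    move=> E'; rewrite -E' in S' N'; apply: N; apply: set_ext => z.
    by split; [apply: S|apply: S'].
  - exists y; split => //; split.
      by move=> u uy i; rewrite (Ex _ (lt_trans uy yx)) (Ey _ uy).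
    by exists k, l; split; [apply/Ex|].
Qed.

Lemma lex_antisym w : is_omega w -> antisymmetric_on (fun f => is_function f p w) lex.
Proof.
  move=> Hw f g Ff Fg [->//|[x [Hx [Ex [n [m [Hn [Hm [S N]]]]]]]]].
  move=> [<-//|[y [Hy [Ey [k [l [Hk [Hl [S' N']]]]]]]]].
  case: (wo_trichotomy Hx Hy) => [xy|[E|yx]].
  - by case: N; apply: functional Ff Hn _; apply/Ey.
  - rewrite -E in Hk Hl; rewrite (functional Fg Hk Hm) (functional Ff Hl Hn) in S'.
    by case: N; apply: set_ext => z; split; [apply: S|apply: S'].
  - by case: N'; apply: functional Fg Hk _; apply/Ex.
Qed.

(** Otherwise [WOAM] gives an amorphous set of functions; [lex] is linear on it, so its antichains
    have at most one element, contradicting [amorphous_antichain]. *)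
Lemma functions_well_orderable w : WOAM M -> is_omega w ->
  exists g q, realizes g (fun f => is_function f p w) /\ well_order g q.
Proof.
  move=> HW Hw; have [g Hg] := functions_ex w.
  have [[q Hq]|[a [Sa Aa]]] := HW g; first by exists g, q.
  have aF f : f ∈ a -> is_function f p w by move=> /Sa/Hg.
  case: (amorphous_antichain dfn_lex Aa).
  - by move=> x y z /aF Hx /aF Hy /aF Hz; apply: (lex_trans Hw).
  - by move=> x y /aF Hx /aF Hy; apply: (lex_antisym Hw).
  - move=> c Hc H; apply: finite_fin; apply: fin_subsingleton => f f' Hf Hf'.
    apply: NNPP => N; apply: (H _ _ Hf Hf' N).
    by apply: (lex_total Hw); apply: aF; apply: Hc.
Qed.

(* The injections of the [S x] into ω are chosen least in a well-order of the
   functions [p -> ω], which [WOAM] provides. *)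
Lemma countable_bigcup c (S : M -> M -> Prop) : WOAM M -> dfn2 S ->
  countable c -> subset c p -> (forall x y, x ∈ c -> S x y -> y ∈ p) ->
  (forall x, x ∈ c -> cnt (S x)) ->
  cnt (fun y => y ∈ c \/ exists x, x ∈ c /\ S x y).
Proof.
  move=> HW dS [w [i [Hw [Fi Ii]]]] cp Sp CS.
  have [g [q [Hg Wq]]] := functions_well_orderable HW Hw.
  (* [h] is total on [p], so that it belongs to the well-ordered set [g]; only its restriction to
     [S x] has to be injective. *)
  pose good x h := is_function h p w /\
    forall u v n, S x u -> S x v -> related h u n -> related h v n -> u = v.
  have dgood : dfn2 good by rewrite /good; solve_dfn.
  pose pick x h := good x h /\ forall h', good x h' -> related q h h'.
  have dpick : dfn2 pick by rewrite /pick; solve_dfn.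
  have good_ex x : x ∈ c -> exists h, good x h.
  { move=> Hx; have [b [Hb [w' [f [Hw' [Ff If]]]]]] := CS _ Hx.
    rewrite (omega_unique Hw' Hw) in Ff.
    (* The given injection of [S x] into ω, extended by the value 0 to the rest of [p]. *)
    have [|h [Rh Hh]] := relation_ex
      (R := fun u n => related f u n \/ (~ u ∈ b /\ empty n)) p w; first solve_dfn.
    have Fb u n : related f u n -> u ∈ b by move=> /(related_mem (proj1 Ff))[].
    exists h; split; first split => //.
    - move=> u Hu; case: (classic (u ∈ b)) => Hub.
      + have [n [Hn Un]] := proj2 Ff _ Hub.
        exists n; split.
          by apply/Hh; split => //; split; [have [] := related_mem (proj1 Ff) Hn|left].
        by move=> m /Hh[_ [_ [/Un|[]]]].
      + have [[e [He Hin]] _] := proj1 Hw.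
        exists e; split; first by apply/Hh; split => //; split => //; right.
        move=> m /Hh[_ [_ [/Fb//|[_ Em]]]].
        by apply: set_ext => z; split=> [/He|/Em].
    - move=> u v n /Hb Su /Hb Sv /Hh[_ [_ [Hu|[]//]]] /Hh[_ [_ [Hv|[]//]]].
      exact: If Hu Hv. }
  have pick_ex x : x ∈ c -> exists h, pick x h.
  { move=> /good_ex[h Gh]; have [_ [_ L]] := Wq.
    have [|b Hb] := separation (P := good x) g; first solve_dfn.
    have [||m [/Hb[Hm Gm] Lm]] := L b.
    - by move=> z /Hb[].
    - by move=> /(_ h); apply; apply/Hb; split => //; apply/Hg; case: Gh.
    - exists m; split => // h' Gh'; apply: Lm; apply/Hb; split => //.
      by apply/Hg; case: Gh'. }
  have pick_unique x h h' : pick x h -> pick x h' -> h = h'.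
  { move=> [G L] [G' L']; have [[_ [_ [A _]]] _] := Wq.
    by apply: A; [apply: L|apply: L']. }
  pose P y := y ∈ c \/ exists x, x ∈ c /\ S x y.
  have dP : dfn1 P by rewrite /P; solve_dfn.
  have Pp y : P y -> y ∈ p by move=> [/cp//|[x [Hx /(Sp _ _ Hx)]]].
  (* An element of [c] is ranked by [i]. An element of a piece [S x] is bounded through both the
     index of [x] and its own value under the picked function, so each bound admits finitely many
     elements. *)
  pose K y n := related i y n \/ exists x k m h, related i x k /\ subset k n /\
    S x y /\ pick x h /\ related h y m /\ subset m n.
  have dK : dfn2 K by rewrite /K; solve_dfn.
  have iw x k : related i x k -> k ∈ w by move=> /(related_mem (proj1 Fi))[].
  have [||R [dR [TR [CR FR]]]] := preorder_of_bounds Hw dP dK.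
  - move=> y [Hy|[x [Hx Sxy]]].
      by have [n [Hn _]] := proj2 Fi _ Hy; exists n; split; [apply: iw Hn|left].
    have [k [Hk _]] := proj2 Fi _ Hx.
    have [h Ph] := pick_ex _ Hx.
    have [[Fh _] _] := Ph.
    have [m [Hm _]] := proj2 Fh _ (Sp _ _ Hx Sxy).
    have [_ Hmw] := related_mem (proj1 Fh) Hm.
    (* The larger of the two numbers bounds both. *)
    by case: (nat_total Hw (iw _ _ Hk) Hmw) => H; [exists m|exists k];
      (split; [by [|apply: iw Hk]|right; exists x, k, m, h]); do 5!split => //.
  - move=> n Hn.
    have Fn : fin (fun k => k ∈ n \/ k = n).
      apply: fin_or; first exact: fin_set (finite_nat Hw Hn).
      by apply: fin_subsingleton => x y -> ->.
    have dFn : dfn1 (fun k => k ∈ n \/ k = n) by solve_dfn.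
    have Fx : fin (fun x => exists k, (k ∈ n \/ k = n) /\ related i x k).
    { apply: (fin_bigcup (R := fun k x => related i x k)) => //; first solve_dfn.
      by move=> k _; apply: fin_subsingleton => x x' H H'; apply: Ii H H'. }
    apply: (fin_sub (P := fun y => related i y n \/
       exists x, (exists k, (k ∈ n \/ k = n) /\ related i x k) /\
         exists m, (m ∈ n \/ m = n) /\ exists h, S x y /\ pick x h /\ related h y m)).
    + solve_dfn.
    + apply: fin_or; first by apply: fin_subsingleton => x x' H H'; apply: Ii H H'.
      apply: (fin_bigcup (R := fun x y => exists m, (m ∈ n \/ m = n) /\
        exists h, S x y /\ pick x h /\ related h y m)) => //; first solve_dfn.
      move=> x _.
      apply: (fin_bigcup (R := fun m y =>
        exists h, S x y /\ pick x h /\ related h y m)) => //; first solve_dfn.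
      move=> m _; apply: fin_subsingleton => y y' [h [Sy [Ph Hy]]] [h' [Sy' [Ph' Hy']]].
      rewrite -(pick_unique _ _ _ Ph Ph') in Hy'.
      by case: Ph => -[_ I] _; apply: I Hy Hy'.
    + move=> y [_ [H|[x [k [m [h [Hk [Sk [Sxy [Ph [Hm Sm]]]]]]]]]]]; first by left.
      have [[Fh _] _] := Ph.
      have [_ Hmw] := related_mem (proj1 Fh) Hm.
      right; exists x; split.
        exists k; split => //.
        by case: (nat_subset_cases Hw Hn (iw _ _ Hk) Sk); auto.
      exists m; split; last by exists h.
      by case: (nat_subset_cases Hw Hn Hmw Sm); auto.
  (* The well-order of [p] breaks the ties between elements of equal rank. *)
  - apply: (countable_of_preorder (L := related s) (R := R) (a := p)) => //.
    + solve_dfn.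
    + by move=> x y z _ _ _; apply: wo_trans.
    + by move=> x y /Pp Hx /Pp Hy; case: WO => _ [C _]; apply: C.
    + by move=> x y _ _; apply: wo_antisym.
Qed.

(** * Greedy subsets and Kurepa's theorem for well-orderable posets *)

(** Transfinite recursion along [s]: each [x] is tested together with the part of [z] already chosen
    before it. *)
Lemma greedy_subset (G : M -> Prop) : dfn1 G -> exists z, subset z p /\
  forall x, x ∈ p -> (x ∈ z <->
    forall a, realizes a (fun u => (u ∈ z /\ lt u x) \/ u = x) -> G a).
Proof.
  move=> dG.
  pose H z x := forall a, realizes a (fun u => (u ∈ z /\ lt u x) \/ u = x) -> G a.
  have dH : dfn2 H by rewrite /H; solve_dfn.
  have H_local z z' x : (forall u, lt u x -> u ∈ z <-> u ∈ z') -> H z x -> H z' x.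
  { move=> E Hz a Ha; apply: Hz => u; rewrite (Ha u).
    by split=> -[[Hu L]|]; [left|right|left|right]; move: (E u); tauto. }
  pose A z x := forall u, u ∈ p -> lt u x -> (u ∈ z <-> H z u).
  have dA : dfn2 A by rewrite /A; solve_dfn.
  have A_unique z z' x : A z x -> A z' x -> forall u, lt u x -> u ∈ z <-> u ∈ z'.
  { move=> Az Az' u ux; have [Hu _] := wo_mem (proj1 ux).
    move: u Hu ux; apply: wo_ind; first solve_dfn.
    move=> u Hu IH ux; rewrite (Az _ Hu ux) (Az' _ Hu ux).
    have E v : lt v u -> v ∈ z <-> v ∈ z'.
      by move=> vu; apply: IH => //; apply: lt_trans vu ux.
    by split; apply: H_local => v /E; tauto. }
  have [|z Hz] := separation (P := fun x => exists z, A z x /\ H z x) p; first solve_dfn.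
  exists z; split; first by move=> x /Hz[].
  apply: wo_ind; first by change (dfn (fun e => e 0 ∈ z <-> H z (e 0))); solve_dfn.
  move=> x Hx IH; rewrite -/(H z x).
  (* By the induction hypothesis the final [z] is itself an approximation below [x]. *)
  have Az : A z x by move=> u Hu /IH.
  split; last by move=> Hzx; apply/Hz; split => //; exists z.
  move=> /Hz[_ [z' [Az' Hz']]].
  by apply: H_local Hz' => u; apply: A_unique Az' Az u.
Qed.

Lemma kurepa_well_ordered r : WOAM M -> partial_order p r ->
  (forall c, antichain p r c -> finite c) ->
  (forall c, chain p r c -> countable c) -> countable p.
Proof.
  move=> HW [Rr [refl [anti trans]]] FA CC.
  apply: NNPP => Np.
  have dcomp : dfn3 (@comparable M) by rewrite /comparable; solve_dfn.
  have comp_sym x y : comparable r x y -> comparable r y x by rewrite /comparable; tauto.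
  have below_ex z x : subset z p -> x ∈ p ->
      exists a, realizes a (fun u => (u ∈ z /\ lt u x) \/ u = x).
  { move=> Sz Hx; apply: (realizable (a := p)); first solve_dfn.
    by move=> u [[/Sz]|->]. }
  (* The second clause keeps uncountably many elements of [p] available at every stage. *)
  pose G a := (forall x y, x ∈ a -> y ∈ a -> x <> y -> ~ comparable r x y) /\
    ~ cnt (fun y => y ∈ p /\ forall x, x ∈ a -> ~ comparable r x y).
  have [|z [zp Hz]] := greedy_subset (G := G); first by rewrite /G; solve_dfn.
  have Az : antichain p r z.
  { split => //.
    suff H x y : x ∈ z -> y ∈ z -> lt x y -> ~ comparable r x y.
      move=> x y Hx Hy N; have [L|[//|L]] := wo_trichotomy (zp _ Hx) (zp _ Hy).
        exact: H L.
      by move=> /comp_sym; apply: H L.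
    move=> Hx Hy L; have [a Ha] := below_ex z y zp (zp _ Hy).
    have [Aa _] := proj1 (Hz _ (zp _ Hy)) Hy _ Ha.
    by apply: Aa; [apply/Ha; left|apply/Ha; right|case: L]. }
  have Fz := FA _ Az.
  (* The test gives [G] only for the part of [z] up to one of its elements; as [z] is finite, the
     part up to its last element is [z]. For empty [z], the claim is the uncountability of [p]. *)
  have Gz : G z.
  { case: (classic (exists x, x ∈ z)) => [Ez|Ez].
    - have [||||m [Hm Mm]] := fin_minimal (P := fun x => x ∈ z) (R := fun x y => lt y x) _ (fin_set Fz).
      + solve_dfn.
      + by move=> x _ [].
      + by move=> x y t _ _ _ yx ty; apply: lt_trans ty yx.
      + done.
      + apply: (proj1 (Hz _ (zp _ Hm)) Hm) => u; split; last by case=> [[]|->].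
        move=> Hu; have [L|[E|L]] := wo_trichotomy (zp _ Hu) (zp _ Hm); auto.
        by case: (Mm _ Hu).
    - split; first by move=> x y Hx; case: Ez; exists x.
      move=> C; apply: Np; apply: countable_cnt; apply: cnt_sub C _; first solve_dfn.
      by move=> y Hy; split => // x Hx; case: Ez; exists x. }
  have [|X HX] := separation
    (P := fun y => forall x, x ∈ z -> ~ comparable r x y) p; first solve_dfn.
  have NX : ~ cnt (fun y => y ∈ X).
  { move=> C; apply: (proj2 Gz); apply: cnt_sub C _; first solve_dfn.
    by move=> y /HX. }
  (* Otherwise [x] would pass the test and enter [z], although it is incomparable to every element
     of [z] and comparable to itself. *)
  have small x : x ∈ X -> cnt (fun y => y ∈ X /\ ~ comparable r x y).
  { move=> /HX[Hx Ix]; apply: NNPP => N.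
    have : x ∈ z; last by move=> /Ix; apply; left; apply: refl.
    apply/(Hz _ Hx) => a Ha; split.
    - have [_ Hanti] := Az.
      move=> u v /Ha[[Hu _]|->] /Ha[[Hv _]|->] // Nuv; [exact: Hanti|exact: Ix|].
      by move=> /comp_sym; apply: Ix.
    - move=> C; apply: N.
      apply: cnt_sub C _; first solve_dfn.
      move=> y [/HX[Hy Iy] Nxy]; split => // u /Ha[[Hu _]|-> //].
      exact: Iy. }
  (* The greedy choice runs through all of [p], so membership in [X] is part of the test. *)
  pose G' a := subset a X /\ forall u v, u ∈ a -> v ∈ a -> comparable r u v.
  have [|c [cp Hc]] := greedy_subset (G := G'); first by rewrite /G'; solve_dfn.
  have cX : subset c X.
  { move=> x Hx; have [a Ha] := below_ex c x cp (cp _ Hx).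
    have [Sa _] := proj1 (Hc _ (cp _ Hx)) Hx _ Ha.
    by apply: Sa; apply/Ha; right. }
  have Cc : chain p r c.
  { split => //.
    have H x y : x ∈ c -> y ∈ c -> lt x y -> comparable r x y.
    { move=> Hx Hy L; have [a Ha] := below_ex c y cp (cp _ Hy).
      have [_ Ca] := proj1 (Hc _ (cp _ Hy)) Hy _ Ha.
      by apply: Ca; apply/Ha; [left|right]. }
    move=> x y Hx Hy; have [L|[<-|L]] := wo_trichotomy (cp _ Hx) (cp _ Hy).
    - exact: H L.
    - by left; apply: refl; apply: cp.
    - by apply: comp_sym; apply: H L. }
  apply: NX.
  have [|||||] := cnt_sub (Q := fun y => y ∈ X) _
    (countable_bigcup (c := c) (S := fun x y => y ∈ X /\ ~ comparable r x y) HW _ (CC _ Cc) cp _ _).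
  - solve_dfn.
  - solve_dfn.
  - by move=> x y _ [/HX[]].
  - by move=> x /cX/small.
  (* An element of [X] comparable to all of [c] passes the test, hence belongs to [c]. *)
  - move=> x Hx; apply: NNPP => /not_or_and[Nc N]; apply: Nc.
    have [Hxp _] := proj1 (HX x) Hx.
    apply/(Hc _ Hxp) => a Ha.
    have comp u : u ∈ c -> comparable r u x.
      by move=> Hu; apply: NNPP => Nu; apply: N; exists u.
    split; first by move=> u /Ha[[/cX]|->].
    move=> u v /Ha[[Hu _]|->] /Ha[[Hv _]|->].
    + by case: Cc => _; apply.
    + exact: comp.
    + by apply: comp_sym; apply: comp.
    + by left; apply: refl.
  - by move=> b Hb; exists b.
Qed.

End WellOrder.

End SetTheory.

Theorem mainTheorem8 :
  forall M : structure, ZF M -> WOAM M -> CAC_aleph0_1 M.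
Proof.
  move=> M HZ HW p r Hr FA CC.
  have [[s WO]|[a [Sa Aa]]] := HW p; first exact: (kurepa_well_ordered HZ WO HW Hr).
  have [_ [_ [anti trans]]] := Hr.
  have dL : dfn2 (related r) by solve_dfn.
  (* Antichains inside [a] are antichains of [p], hence finite, which is impossible for an amorphous
     set. *)
  case: (amorphous_antichain HZ dL Aa).
  - by move=> x y z _ _ _; apply: trans.
  - by move=> x y _ _; apply: anti.
  - move=> c Hc H; apply: FA; split; first by move=> x /Hc/Sa.
    exact: H.
Qed.
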